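(* Let $N \geq 2$ be an integer and let $1 < p < p_S$, where $p_S = \infty$ if $N = 2$ and $p_S = (N+2)/(N-2)$ if $N \geq 3$. Suppose $u : \mathbb{R}^N \to \mathbb{R}$ is a non-negative classical solution of $$\Delta u + u^p = 0 \quad \text{in } \mathbb{R}^N.$$ Then $u \equiv 0$.
   Context: A solution of $\Delta u + u^p = 0$ is always understood in the classical sense, i.e. $u$ is twice continuously differentiable and satisfies the equation pointwise on $\mathbb{R}^N$. *)

(* Defs.v *)
From HB Require Import structures.
From mathcomp Require Import all_boot all_order all_algebra.
From mathcomp Require Import all_classical all_reals all_analysis.

Set Implicit Arguments.
Unset Strict Implicit.
Unset Printing Implicit Defensive.

Import Order.TTheory GRing.Theory Num.Theory.
Import numFieldNormedType.Exports.

Local Open Scope classical_set_scope.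
Local Open Scope ring_scope.

(* R^N is 'rV[R]_N; its library norm is the sup norm, which induces the usual
   topology, and the norm enters below only through limits and continuity. *)

Definition pderiv (R : realType) (N : nat) (i : 'I_N) (f : 'rV[R]_N -> R) :
    'rV[R]_N -> R :=
  fun x => 'D_(delta_mx 0 i) f x.

(* 'D_v f x is total (a default value if the limit does not exist), so the
   existence of the partial derivatives has to be required separately. *)
Definition is_C1 (R : realType) (N : nat) (f : 'rV[R]_N -> R) : Prop :=
  [/\ continuous f,
      forall (i : 'I_N) (x : 'rV[R]_N), derivable f x (delta_mx 0 i)
    & forall i : 'I_N, continuous (pderiv i f)].

Definition is_C2 (R : realType) (N : nat) (f : 'rV[R]_N -> R) : Prop :=
  is_C1 f /\ forall i : 'I_N, is_C1 (pderiv i f).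

Definition laplacian (R : realType) (N : nat) (f : 'rV[R]_N -> R)
    (x : 'rV[R]_N) : R :=
  \sum_(i < N) pderiv i (pderiv i f) x.

(* The real power a `^ p has its usual meaning for 0 <= a (with 0 `^ p = 0 for
   p != 0); its value for a < 0 is a junk value, so this is meant for u >= 0. *)
Definition classical_solution (R : realType) (N : nat) (p : R)
    (u : 'rV[R]_N -> R) : Prop :=
  is_C2 u /\ forall x : 'rV[R]_N, laplacian u x + u x `^ p = 0.

(* Meant for 2 <= N. *)
Definition sobolev_exponent (R : realType) (N : nat) : \bar R :=
  if N == 2%N then +oo%E else ((N%:R + 2) / (N%:R - 2))%:E.

(* Main.v *)
(* The proof is by moving spheres. For N >= 3 a nonzero solution u is positive.
   Let u_(x,lambda) be its Kelvin transform with respect to the sphere of center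
   x and radius lambda. Subcriticality makes u - u_(x,lambda) strictly
   superharmonic outside that sphere wherever it is nonnegative, so the set of
   radii lambda for which u_(x,lambda) <= u outside the sphere is open (minimum
   principle and Hopf's lemma), besides being closed and containing all small
   radii. The inequality thus holds for all centers and radii, and letting the
   center go to infinity along a line gives u z <= u y for all y and z: u is
   constant, hence zero. For N = 2 nonnegative superharmonic functions are
   already constant. Everything rests on the pointwise minimum principle; no
   integration is involved. *)
Require Import Defs.
From HB Require Import structures.
From mathcomp Require Import all_boot all_order all_algebra.
From mathcomp Require Import all_classical all_reals all_analysis.
From mathcomp Require Import ring lra.

Set Implicit Arguments.
Unset Strict Implicit.
Unset Printing Implicit Defensive.

Import Order.TTheory GRing.Theory Num.Theory.
Import numFieldNormedType.Exports.
Local Open Scope classical_set_scope.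
Local Open Scope ring_scope.

(** The exterior of a sphere is not compact, so when the radius grows the inequality between [u] and
    its transform could fail first at infinity. What prevents this is a matching of decay rates: a
    nonnegative superharmonic function decays no faster than |y|^(2 - N), and the Kelvin transform
    has exactly this decay. With [k = (N - 2) / 2] the common profile is [(A / normsq y) ^ k], which
    is harmonic and serves as the barrier throughout. The sign of the Laplacian of the difference is
    strict, so at an interior minimum the second derivative test along the axes already gives a
    contradiction, and no strong maximum principle has to be proved. Radii enter through their
    squares [L]. All spheres are centered at 0; other centers are reached by translating [u]. *)

(** * Total differentiability and the chain rule for C^1 functions *)

Lemma cvg_sum_fin (R : realType) (T : Type) (F : set_system T) {FF : Filter F}
    (I : finType) (f : I -> T -> R) (l : I -> R) :
  (forall i, f i x @[x --> F] --> l i) ->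
  \sum_i f i x @[x --> F] --> \sum_i l i.
Proof.
move=> fl; elim: (index_enum I) => [|i r IH].
  by rewrite big_nil; under eq_fun do rewrite big_nil; exact: cvg_cst.
by rewrite big_cons; under eq_fun do rewrite big_cons; exact: cvgD.
Qed.

Lemma is_derive_line (R : realType) (N : nat) (f : 'rV[R]_N -> R)
    (v x : 'rV[R]_N) (t : R) :
  derivable f (x + t *: v) v ->
  is_derive t 1 (fun s : R => f (x + s *: v)) ('D_v f (x + t *: v)).
Proof.
move=> df.
have E : (fun h : R => h^-1 *: (f (x + (h *: (1 : R) + t) *: v)
           - f (x + t *: v)))
       = (fun h : R => h^-1 *: (f (h *: v + (x + t *: v)) - f (x + t *: v))).
  apply/funext => h; congr (_ *: (f _ - _)).
  by rewrite [h *: _]mulr1 scalerDl addrCA.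
apply: DeriveDef; first by rewrite /derivable /= E.
by rewrite /derive /= E.
Qed.

Lemma MVT_from0 (R : realType) (g dg : R -> R) (a : R) :
  (forall x : R, is_derive x 1 g (dg x)) ->
  exists2 s, 0 <= s <= 1 & g a - g 0 = a * dg (s * a).
Proof.
move=> dgx.
have gc : continuous g.
  move=> x; apply: differentiable_continuous.
  by apply/derivable1_diffP; case: (dgx x).
have [a0|a0|->] := ltgtP a 0.
- have [c] := @MVT _ g dg a 0 a0 (fun x _ => dgx x) (continuous_subspaceT gc).
  rewrite in_itv /= => /andP[ac c0] E.
  exists (c / a).
    by rewrite ler_ndivlMr // ler_ndivrMr // mul0r mul1r !ltW.
  rewrite mulfVK ?lt_eqF //; move: E; lra.
- have [c] := @MVT _ g dg 0 a a0 (fun x _ => dgx x) (continuous_subspaceT gc).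
  rewrite in_itv /= => /andP[c0 ca] E.
  exists (c / a).
    by rewrite ler_pdivlMr // ler_pdivrMr // mul0r mul1r !ltW.
  rewrite mulfVK ?gt_eqF //; move: E; lra.
- by exists 0; rewrite ?lexx ?ler01 // subrr mul0r.
Qed.

Lemma is_C1_line (R : realType) (N : nat) (f : 'rV[R]_N -> R) (i : 'I_N)
    (x : 'rV[R]_N) (t : R) : is_C1 f ->
  is_derive t 1 (fun s : R => f (x + s *: delta_mx 0 i))
    (pderiv i f (x + t *: delta_mx 0 i)).
Proof. by case=> _ df _; apply: is_derive_line. Qed.

(* Coordinates [< j] are taken from [v], so that [f (x + v) - f x] telescopes
   along the coordinate axes. *)
Definition trunc_row (R : realType) (N j : nat) (v : 'rV[R]_N) : 'rV[R]_N :=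
  \row_(i < N) (if (i < j)%N then v 0 i else 0).

Lemma trunc_rowS (R : realType) (N : nat) (j : 'I_N) (v : 'rV[R]_N) :
  trunc_row j.+1 v = trunc_row j v + v 0 j *: delta_mx 0 j.
Proof.
apply/rowP => i; rewrite !mxE eqxx /= -val_eqE /= ltnS leq_eqVlt.
case: (eqVneq (i : nat) j) => [e|] /=; last by rewrite mulr0 addr0.
by rewrite e ltnn add0r mulr1; congr (v 0 _); apply: val_inj.
Qed.

Lemma is_C1_increment (R : realType) (N : nat) (f : 'rV[R]_N -> R)
    (x : 'rV[R]_N) (e : R) : is_C1 f -> 0 < e ->
  \forall v \near (0 : 'rV[R]_N),
    `|f (x + v) - f x - \sum_(j < N) v 0 j * pderiv j f x| <= e * `|v|.
Proof.
move=> f1 e0; have [fc df dfc] := f1.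
(* Dividing by [N + 1] instead of [N] keeps the case [N = 0] harmless. *)
have N1 : 0 < N%:R + 1 :> R by rewrite ltr_wpDl.
have e1 : 0 < e / (N%:R + 1) by rewrite divr_gt0.
have Hj (j : 'I_N) : \forall v \near (0 : 'rV[R]_N),
    `|pderiv j f x - pderiv j f (x + v)| < e / (N%:R + 1).
  have : pderiv j f (x + v) @[v --> (0 : 'rV[R]_N)] --> pderiv j f x.
    rewrite -{2}[x]addr0; apply: (@continuous_comp _ _ _ (fun v => x + v) (pderiv j f)).
      by apply: continuousD; [exact: cst_continuous|].
    exact: dfc.
  by move/cvgrPdist_lt => /(_ _ e1).
have H := filter_forall (nbhs_filter _) Hj.
have [d /= d0 Hd] := (nbhs_ballP _ _).1 H.
near=> v.
have vd : `|v| < d.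
  near: v; apply/nbhs_ballP; exists d => //= v.
  by rewrite -ball_normE /= sub0r normrN.
have -> : f (x + v) - f x - \sum_(j < N) v 0 j * pderiv j f x =
    \sum_(j < N) (f (x + trunc_row j.+1 v) - f (x + trunc_row j v)
                  - v 0 j * pderiv j f x).
  rewrite sumrB; congr (_ - _).
  rewrite -(big_mkord xpredT (fun j => f (x + trunc_row j.+1 v) - f (x + trunc_row j v))).
  rewrite telescope_sumr //; congr (f _ - f _).
    by congr (_ + _); apply/rowP => i; rewrite mxE ltn_ord.
  by rewrite (_ : trunc_row 0 v = 0) ?addr0 //; apply/rowP => i; rewrite !mxE.
apply: (le_trans (ler_norm_sum _ _ _)).
have vj (j : 'I_N) : `|v 0 j| <= `|v|.
  rewrite [leRHS]/Num.norm /= mx_normrE.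
  exact: (le_bigmax _ (fun i : 'I_1 * 'I_N => `|v i.1 i.2|) (0, j)).
apply: (@le_trans _ _ (\sum_(j < N) (e / (N%:R + 1) * `|v|))); last first.
  rewrite sumr_const card_ord -[leLHS]mulr_natl mulrA ler_wpM2r //.
  by rewrite mulrCA ler_piMr ?(ltW e0) // ler_pdivrMr // mul1r lerDl.
apply: ler_sum => j _.
have [s /andP[s0 s1] ->] : exists2 s, 0 <= s <= 1 &
    f (x + trunc_row j.+1 v) - f (x + trunc_row j v)
    = v 0 j * pderiv j f (x + trunc_row j v + (s * v 0 j) *: delta_mx 0 j).
  have [s hs E] := @MVT_from0 _ _ _ (v 0 j)
    (fun t => @is_C1_line _ _ f j (x + trunc_row j v) t f1).
  by exists s => //; rewrite -E scale0r addr0 trunc_rowS addrA.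
rewrite -mulrBr normrM mulrC ler_pM // distrC.
apply/ltW; rewrite -addrA.
apply: Hd; rewrite -ball_normE /= sub0r normrN.
apply: le_lt_trans vd.
rewrite [leLHS]/Num.norm /= mx_normrE; apply/bigmax_leP; split => //= -[i0 i] _ /=.
rewrite !mxE (ord1 i0) eqxx /=.
case: (eqVneq i j) => [->|ij] /=.
  rewrite ltnn add0r mulr1 normrM ger0_norm //.
  by rewrite (le_trans _ (vj j)) // ler_piMl.
rewrite mulr0 addr0; case: ifP => _ //; by rewrite normr0.
Unshelve. all: by end_near. Qed.

(** Inversion bends the coordinate lines, so partial derivatives alone cannot differentiate a Kelvin
    transform: [f] has to be followed along a curve. Up to a small multiple of the increment of [c],
    [f] is replaced by its linear part [S]. *)
Lemma is_C1_chain (R : realType) (N : nat) (f : 'rV[R]_N -> R)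
    (c : R -> 'rV[R]_N) (dc : 'I_N -> R) (t : R) : is_C1 f ->
  (forall j, is_derive t 1 (fun s => c s 0 j) (dc j)) ->
  is_derive t 1 (f \o c) (\sum_(j < N) dc j * pderiv j f (c t)).
Proof.
move=> f1 Hc.
have dcv : derivable c t 1.
  by apply/derivable_mxP => i j; rewrite (ord1 i); case: (Hc j).
have cc : {for t, continuous c}.
  by apply: differentiable_continuous; apply/derivable1_diffP.
have cquot : (fun h : R => h^-1 *: (c (h + t) - c t)) @ 0^' --> 'D_1 c t.
  have := dcv; rewrite /derivable /= => /cvg_ex[l cl].
  rewrite /derive (cvg_lim _ cl) //.
  by move: cl; under eq_fun do rewrite [_ *: (1 : R)]mulr1.
have Dc j : 'D_1 c t 0 j = dc j.
  by rewrite derive_mx // mxE; case: (Hc j).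
pose S (v : 'rV[R]_N) := \sum_(j < N) v 0 j * pderiv j f (c t) : R.
have -> : \sum_(j < N) dc j * pderiv j f (c t) = S ('D_1 c t).
  by apply: eq_bigr => j _; rewrite Dc.
have Sc : continuous S.
  move=> v; apply: (@cvg_sum_fin R _ (nbhs v) _ _ (fun j (w : 'rV[R]_N) =>
    w 0 j * pderiv j f (c t))) => j; apply: cvgM; last exact: cvg_cst.
  exact: coord_continuous.
suff L : (fun h : R => h^-1 *: (f (c (h *: (1:R) + t)) - f (c t))) @ 0^'
     --> S ('D_1 c t).
  apply: DeriveDef; first by apply/cvg_ex; exists (S ('D_1 c t)).
  exact: cvg_lim L.
under eq_fun do rewrite [_ *: (1 : R)]mulr1.
have SL : S (h^-1 *: (c (h + t) - c t)) @[h --> 0^'] --> S ('D_1 c t).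
  by apply: continuous_cvg => //; exact: Sc.
apply/cvgrPdist_le => e e0.
have e2 : 0 < e / 2 by rewrite divr_gt0.
pose M := `|'D_1 c t| + 1.
have M0 : 0 < M by rewrite ltr_wpDl.
have := @is_C1_increment _ _ f (c t) _ f1 (divr_gt0 e2 M0).
move=> Hinc.
have c0 : c (h + t) - c t @[h --> 0^'] --> (0 : 'rV[R]_N).
  have : c (h + t) - c t @[h --> (0:R)] --> (0 : 'rV[R]_N).
    rewrite -(subrr (c t)); apply: cvgB; last exact: cvg_cst.
    rewrite -{2}[t]add0r.
    apply: (@continuous_comp _ _ _ (fun h => h + t) c).
      by apply: continuousD; [|exact: cst_continuous].
    by rewrite /continuous_at add0r; exact: cc.
  by apply: cvg_trans; apply: cvg_app; apply: nbhs_dnbhs.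
have H1 := c0 _ Hinc.
move/cvgrPdist_le : SL => /(_ _ e2) H2.
have H3 : \forall h \near 0^', `|h^-1 *: (c (h + t) - c t)| <= M.
  move/cvgrPdist_le : cquot => /(_ _ ltr01).
  apply: filterS => h Hh; rewrite /M.
  rewrite -[X in `|X|](subrK ('D_1 c t)) addrC.
  by rewrite (le_trans (ler_normD _ _)) // lerD2l distrC.
near=> h.
have h0 : h != 0 by near: h; exact: nbhs_dnbhs_neq.
have K1 : `|f (c t + (c (h + t) - c t)) - f (c t) - S (c (h + t) - c t)|
     <= e / 2 / M * `|c (h + t) - c t| by near: h; exact: H1.
have K2 : `|S ('D_1 c t) - S (h^-1 *: (c (h + t) - c t))| <= e / 2.
  by near: h; exact: H2.
have K3 : `|h^-1 *: (c (h + t) - c t)| <= M by near: h; exact: H3.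
move: K1; rewrite [c t + _]addrC subrK => K1.
have SZ a v : S (a *: v) = a * S v.
  by rewrite /S mulr_sumr; apply: eq_bigr => j _; rewrite mxE mulrA.
rewrite -(subrKA (S (h^-1 *: (c (h + t) - c t)))) (le_trans (ler_normD _ _)) //.
rewrite [leRHS]splitr lerD // SZ -[h^-1 *: (_ : R)]/(h^-1 * _) -mulrBr.
rewrite normrM distrC.
move: K3; rewrite normrZ => K3.
apply: le_trans (ler_wpM2l (normr_ge0 _) K1) _.
rewrite mulrCA; apply: le_trans (ler_wpM2l _ K3) _.
  by rewrite ltW // divr_gt0.
by rewrite divfK // gt_eqF.
Unshelve. all: by end_near. Qed.

(** * Second derivatives and the pointwise Laplacian *)

Lemma is_derive_quotient (R : realType) (g : R -> R) (x d : R) :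
  is_derive x 1 g d -> (h^-1 * (g (h + x) - g x)) @[h --> 0^'] --> d.
Proof.
case=> dg <-; have := dg; rewrite /derivable /= => /cvg_ex[l cl].
rewrite /derive (cvg_lim _ cl) //.
by move: cl; under eq_fun do rewrite [_ *: (1 : R)]mulr1.
Qed.

Definition second_deriv (R : realType) (g : R -> R) (d : R) : Prop :=
  exists2 g1 : R -> R, \forall t \near (0 : R), is_derive (t : R) 1 g (g1 t)
    & is_derive (0 : R) 1 g1 d.

Lemma second_derivD (R : realType) (f g : R -> R) (a b : R) :
  second_deriv f a -> second_deriv g b ->
  second_deriv (fun t => f t + g t) (a + b).
Proof.
move=> [f1 df1 df2] [g1 dg1 dg2]; exists (fun t => f1 t + g1 t).
  by near=> t; apply: is_deriveD; near: t.
exact: is_deriveD.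
Unshelve. all: by end_near. Qed.

Lemma second_derivZ (R : realType) (f : R -> R) (a c : R) :
  second_deriv f a -> second_deriv (fun t => c * f t) (c * a).
Proof.
move=> [f1 df1 df2]; exists (fun t => c * f1 t).
  by near=> t; apply: (@is_deriveZ _ _ _ f); near: t.
exact: (@is_deriveZ _ _ _ f1).
Unshelve. all: by end_near. Qed.

Lemma second_deriv_cst (R : realType) (c : R) :
  second_deriv (fun=> c) 0.
Proof.
exists (fun=> 0); last exact: is_derive_cst.
by near=> t; exact: is_derive_cst.
Unshelve. all: by end_near. Qed.

(** At the minimum [g1 0 = 0]; if [d < 0], then [g1] is negative just to the right of 0 and the mean
    value theorem puts [g m] below [g 0]. *)
Lemma second_deriv_min (R : realType) (g : R -> R) (d : R) :
  second_deriv g d -> (\forall t \near (0 : R), g 0 <= g t) -> 0 <= d.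
Proof.
move=> [g1 dg1 dg2] gmin; rewrite leNgt; apply/negP => d0.
have /nbhs_ballP[e /= e0 He] : \forall t \near 0,
    is_derive (t : R) 1 g (g1 t) /\ g 0 <= g t.
  by near=> t; split; near: t.
have He' t : t \in `](- e), e[ -> is_derive (t : R) 1 g (g1 t) /\ g 0 <= g t.
  move=> te; apply: He; rewrite -ball_normE /= sub0r normrN ltr_norml.
  by rewrite in_itv in te.
have He0 : 0 \in `](- e), e[ by rewrite in_itv /= oppr_lt0 e0.
have g10 : g1 0 = 0.
  have [D _] := He' _ He0.
  have D0 : is_derive (0 : R) 1 g 0.
    apply: (@derive1_at_min _ g (- e) e 0) => //.
    - by move: e0; lra.
    - by move=> t /He'[[]].
    - by move=> t /He'[].
  by case: D => _ <-; case: D0.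
have Q := is_derive_quotient dg2.
have d2 : 0 < - d by rewrite oppr_gt0.
move/cvgrPdist_lt : Q => /(_ _ d2).
rewrite /dnbhs /within /= => /nbhs_ballP[r /= r0 Hr].
pose m := Num.min (e / 2) (r / 2).
have m0 : 0 < m by rewrite lt_min !divr_gt0.
have me : m < e by rewrite gt_min ltr_pdivrMr // ltr_pMr // ltr1n.
have mr : m < r by rewrite gt_min orbC ltr_pdivrMr // ltr_pMr // ltr1n.
have sub t : t \in `[0, m] -> t \in `](- e), e[.
  rewrite !in_itv /= => /andP[t0 tm]; rewrite (le_lt_trans tm me) andbT.
  by rewrite (lt_le_trans _ t0) // oppr_lt0.
have [||c] := @MVT _ g g1 0 m m0.
- by move=> x xm; apply (He' x); apply: sub; apply: subset_itvW xm.
- apply: derivable_within_continuous => x xm.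
  by have [[]] := He' _ (sub _ xm).
rewrite in_itv /= subr0 => /andP[c0 cm] E.
have := Hr c; rewrite -ball_normE /= sub0r normrN gtr0_norm // => /(_ (lt_trans cm mr)).
rewrite addr0 g10 subr0 => /(_ (lt0r_neq0 c0)) => Hc.
have gc : g1 c < 0.
  rewrite -(pmulr_rlt0 _ (x := c^-1)) ?invr_gt0 //.
  move: Hc; rewrite ltr_norml; lra.
have mm : m \in `[0, m] by rewrite in_itv /= lexx ltW.
have [_] := He' m (sub _ mm).
have : g1 c * m < 0 by rewrite nmulr_rlt0.
by move: E; lra.
Unshelve. all: by end_near. Qed.

(* The Laplacian at a single point, read off along the coordinate lines: it
   applies to functions that are smooth near that point only, such as Kelvin
   transforms. *)
Definition has_lap (R : realType) (N : nat) (f : 'rV[R]_N -> R)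
    (y : 'rV[R]_N) (l : R) : Prop :=
  exists2 d : 'I_N -> R,
    forall i, second_deriv (fun t => f (y + t *: delta_mx 0 i)) (d i)
  & l = \sum_(i < N) d i.

Lemma has_lapD (R : realType) (N : nat) (f g : 'rV[R]_N -> R)
    (y : 'rV[R]_N) (a b : R) :
  has_lap f y a -> has_lap g y b -> has_lap (fun x => f x + g x) y (a + b).
Proof.
move=> [d dP ->] [e eP ->]; exists (fun i => d i + e i).
  by move=> i; exact: second_derivD.
by rewrite big_split.
Qed.

Lemma has_lapZ (R : realType) (N : nat) (f : 'rV[R]_N -> R)
    (y : 'rV[R]_N) (c a : R) :
  has_lap f y a -> has_lap (fun x => c * f x) y (c * a).
Proof.
move=> [d dP ->]; exists (fun i => c * d i).
  by move=> i; exact: second_derivZ.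
by rewrite mulr_sumr.
Qed.

Lemma has_lap_cst (R : realType) (N : nat) (y : 'rV[R]_N) (c : R) :
  has_lap (fun=> c) y 0.
Proof.
exists (fun=> 0); first by move=> i; exact: second_deriv_cst.
by rewrite big1.
Qed.

Lemma has_lap_min (R : realType) (N : nat) (f : 'rV[R]_N -> R)
    (y : 'rV[R]_N) (l : R) :
  has_lap f y l -> (\forall z \near y, f y <= f z) -> 0 <= l.
Proof.
move=> [d dP ->] fmin; apply: sumr_ge0 => i _.
apply: second_deriv_min (dP i) _; rewrite scale0r addr0.
have : y + t *: delta_mx 0 i @[t --> (0 : R)] --> y.
  rewrite -{2}[y]addr0 -(scale0r (delta_mx 0 i)).
  by apply: cvgD; [exact: cvg_cst|exact: scalel_continuous].
by move=> /(_ _ fmin).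
Qed.

Lemma is_C2_has_lap (R : realType) (N : nat) (f : 'rV[R]_N -> R)
    (y : 'rV[R]_N) : is_C2 f -> has_lap f y (laplacian f y).
Proof.
move=> [f1 f2]; exists (fun i => pderiv i (pderiv i f) y) => // i.
exists (fun t => pderiv i f (y + t *: delta_mx 0 i)).
  by near=> t; exact: is_C1_line.
by have := @is_C1_line _ _ _ i y 0 (f2 i); rewrite scale0r addr0.
Unshelve. all: by end_near. Qed.

(** * The Euclidean norm and the Laplacian of its powers *)

Definition normsq (R : realType) (N : nat) (y : 'rV[R]_N) : R :=
  \sum_(i < N) y 0 i ^+ 2.

Lemma normsq_ge0 (R : realType) (N : nat) (y : 'rV[R]_N) : 0 <= normsq y.
Proof. by apply: sumr_ge0 => i _; exact: sqr_ge0. Qed.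

Lemma normsqZ (R : realType) (N : nat) (a : R) (y : 'rV[R]_N) :
  normsq (a *: y) = a ^+ 2 * normsq y.
Proof.
by rewrite /normsq mulr_sumr; apply: eq_bigr => i _; rewrite mxE exprMn.
Qed.

Lemma normsq0 (R : realType) (N : nat) : normsq (0 : 'rV[R]_N) = 0.
Proof. by apply: big1 => i _; rewrite mxE expr0n. Qed.

Lemma normsq_line (R : realType) (N : nat) (y : 'rV[R]_N) (i : 'I_N) (t : R) :
  normsq (y + t *: delta_mx 0 i) = normsq y + 2 * y 0 i * t + t ^+ 2.
Proof.
rewrite /normsq (bigD1 i) //= [in RHS](bigD1 i) //= !mxE !eqxx /= mulr1.
rewrite (eq_bigr (fun j => y 0 j ^+ 2)); first by ring.
by move=> j ji; rewrite !mxE (negbTE ji) andbF mulr0 addr0.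
Qed.

Lemma exists_normsq (R : realType) (N : nat) (A : R) :
  (0 < N)%N -> 0 <= A -> exists e : 'rV[R]_N, normsq e = A.
Proof.
move=> N0 A0; exists (0 + Num.sqrt A *: delta_mx 0 (Ordinal N0)).
by rewrite normsq_line normsq0 mxE mulr0 mul0r !add0r sqr_sqrtr.
Qed.

Lemma normsq_continuous (R : realType) (N : nat) :
  continuous (@normsq R N).
Proof.
move=> y.
apply: (@cvg_sum_fin R _ (nbhs y) _ _ (fun i (z : 'rV[R]_N) => z 0 i ^+ 2)) => i.
rewrite expr2; under eq_fun do rewrite expr2.
by apply: cvgM; exact: coord_continuous.
Qed.

(** The logarithmic derivative of [L / normsq] along the [i]-th coordinate line through [y], for
    [Q = normsq y] and [a = y 0 i]; it does not depend on [L]. *)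
Definition logder (R : realType) (Q a t : R) : R :=
  - (2 * (a + t)) / (Q + 2 * a * t + t ^+ 2).

Lemma is_derive_quadratic (R : realType) (Q a t : R) :
  is_derive (t : R) 1 (fun s : R => Q + 2 * a * s + s ^+ 2) (2 * (a + t)).
Proof.
have H1 : is_derive (t : R) 1 (fun s : R => 2 * a * s) (2 * a).
  apply: is_derive_eq (@is_deriveZ _ _ _ id (2 * a) t 1 1 _) _.
  by rewrite [_ *: _]mulr1.
have H2 : is_derive (t : R) 1 (fun s : R => s ^+ 2) (2 * t).
  apply: is_derive_eq (@is_deriveX _ _ id 2 t 1 1 (is_derive_id _ _)) _.
  by rewrite /= expr1 [_ *: _]mulr1.
apply: is_derive_eq (is_deriveD (is_deriveD (is_derive_cst Q t 1) H1) H2) _.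
by ring.
Qed.

Lemma is_derive_inv_quadratic (R : realType) (L Q a t : R) :
  0 < Q + 2 * a * t + t ^+ 2 ->
  is_derive (t : R) 1 (fun s : R => L / (Q + 2 * a * s + s ^+ 2))
    (L / (Q + 2 * a * t + t ^+ 2) * logder Q a t).
Proof.
move=> q0.
have q0' : Q + 2 * a * t + t ^+ 2 != 0 by rewrite gt_eqF.
have D := @is_deriveV R _ t _ 1 q0' (is_derive_quadratic Q a t).
apply: is_derive_eq (@is_deriveZ _ _ _ _ L t 1 _ D) _.
rewrite /logder -![_ *: _]/(_ * _).
field.
by rewrite q0'.
Qed.

Lemma is_derive_logder (R : realType) (Q a t : R) :
  0 < Q + 2 * a * t + t ^+ 2 ->
  is_derive (t : R) 1 (logder Q a)
    (logder Q a t ^+ 2 - 2 / (Q + 2 * a * t + t ^+ 2)).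
Proof.
move=> q0.
have q0' : Q + 2 * a * t + t ^+ 2 != 0 by rewrite gt_eqF.
have D := @is_deriveV R _ t _ 1 q0' (is_derive_quadratic Q a t).
have D2 : is_derive (t : R) 1 (fun s : R => - (2 * (a + s))) (- 2).
  have H := is_deriveD (is_derive_cst a t 1) (is_derive_id t (1 : R)).
  apply: is_derive_eq (is_deriveN (@is_deriveZ _ _ _ _ 2 t 1 _ H)) _.
  by rewrite add0r [_ *: _]mulr1.
apply: is_derive_eq (is_deriveM D2 D) _.
rewrite /logder -![_ *: _]/(_ * _).
field.
by rewrite q0'.
Qed.

(** Phrased with logarithmic derivatives, which a power [b] simply multiplies by [b]. *)
Lemma is_derive_powR_comp (R : realType) (f : R -> R) (df b t : R) :
  0 < f t -> is_derive (t : R) 1 f (f t * df) ->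
  is_derive (t : R) 1 (fun s : R => f s `^ b) (b * (f t `^ b * df)).
Proof.
move=> f0 D.
have P := @is_derive1_powR R b _ f0.
apply: is_derive_eq (@is_derive1_comp _ (fun x => x `^ b) f t _ _ P D) _.
rewrite powRB ?powRr1 ?(ltW f0) ?(gt_eqF f0) ?implybT //.
by field; rewrite gt_eqF.
Qed.

Lemma second_deriv_inv_quadratic_powR (R : realType) (L Q a b : R) :
  0 < L -> 0 < Q ->
  second_deriv (fun t => (L / (Q + 2 * a * t + t ^+ 2)) `^ b)
    (b * ((L / Q) `^ b * ((b + 1) * logder Q a 0 ^+ 2 - 2 / Q))).
Proof.
move=> L0 Q0.
pose q t := Q + 2 * a * t + t ^+ 2.
have D t : 0 < q t -> is_derive (t : R) 1 (fun t => (L / q t) `^ b)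
    (b * ((L / q t) `^ b * logder Q a t)).
  move=> qt; apply: is_derive_powR_comp; first by rewrite divr_gt0.
  exact: is_derive_inv_quadratic.
have q0 : q 0 = Q by rewrite /q; ring.
have q00 : 0 < q 0 by rewrite q0.
exists (fun t => b * ((L / q t) `^ b * logder Q a t)).
  have qc : {for (0 : R), continuous q}.
    apply: differentiable_continuous; apply/derivable1_diffP.
    by have [] := is_derive_quadratic Q a 0.
  have : \forall t \near (0 : R), 0 < q t by exact: qc _ (lt_nbhsr q00).
  by apply: filterS => t; exact: D.
have D2 := is_deriveM (D 0 q00) (is_derive_logder q00).
have D3 := @is_deriveZ _ _ _
  (fun t => (L / q t) `^ b * logder Q a t) b 0 1 _ D2.
apply: is_derive_eq D3 _.
rewrite -/(q 0) q0 -![_ *: _]/(_ * _).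
field.
by rewrite gt_eqF.
Qed.

(** The factor [2 * b + 2 - N] vanishes for [b = (N - 2) / 2], the fundamental solution, and is
    positive for larger [b]; both cases serve as barriers. *)
Lemma has_lap_inv_powR (R : realType) (N : nat) (L b : R) (y : 'rV[R]_N) :
  0 < L -> 0 < normsq y ->
  has_lap (fun x => (L / normsq x) `^ b) y
    (2 * b * (2 * b + 2 - N%:R) * ((L / normsq y) `^ b / normsq y)).
Proof.
move=> L0 y0; have y0' : normsq y != 0 by rewrite gt_eqF.
exists (fun i => b * ((L / normsq y) `^ b *
    ((b + 1) * logder (normsq y) (y 0 i) 0 ^+ 2 - 2 / normsq y))).
  move=> i; have := second_deriv_inv_quadratic_powR (y 0 i) b L0 y0.
  by under eq_fun do rewrite -normsq_line.
rewrite -!mulr_sumr sumrB -mulr_sumr sumr_const card_ord.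
have -> : \sum_(i < N) logder (normsq y) (y 0 i) 0 ^+ 2 = 4 / normsq y.
  rewrite (eq_bigr (fun i => 4 / normsq y ^+ 2 * y 0 i ^+ 2)).
    by rewrite -mulr_sumr -/(normsq y); field.
  by move=> i _; rewrite /logder mulr0 expr0n !addr0; field.
rewrite -[2 / _ *+ N]mulr_natr.
by field.
Qed.

(** * Laplacian of the Kelvin transform *)

Lemma sum_delta (R : realType) (N : nat) (f : 'I_N -> R) (j : 'I_N) :
  \sum_(i < N) f i * (j == i)%:R = f j.
Proof.
rewrite (bigD1 j) //= eqxx mulr1 big1 ?addr0 // => i ij.
by rewrite eq_sym (negbTE ij) mulr0.
Qed.

(* Up to the factor [r], [A i j] is the derivative in direction [i] of the
   [j]-th coordinate of the inversion; the orthogonality of its rows makes only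
   the trace of the Hessian [H] survive, while the zeroth and first order terms
   cancel exactly when [N = 2 k + 2]. *)
Lemma kelvin_sum (R : realType) (N : nat) (y : 'rV[R]_N) (w : 'I_N -> R)
    (H : 'I_N -> 'I_N -> R) (k G r U : R) (s tau : 'I_N -> R)
    (A : 'I_N -> 'I_N -> R) :
  normsq y != 0 -> N%:R = 2 * k + 2 ->
  (forall i, s i = - (2 * y 0 i) / normsq y) ->
  (forall i, tau i = s i ^+ 2 - 2 / normsq y) ->
  (forall i j, A i j = s i * y 0 j + (j == i)%:R) ->
  \sum_(i < N) (k * (k * G * s i ^+ 2 + G * tau i) * U
    + 2 * (k * G * s i) * (\sum_(j < N) r * A i j * w j)
    + G * \sum_(j < N) ((r * s i * A i j
                         + r * (tau i * y 0 j + s i * (j == i)%:R)) * w j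
                        + r * A i j * \sum_(l < N) r * A i l * H j l))
  = G * r ^+ 2 * \sum_(j < N) H j j.
Proof.
move=> Q0 Nk sE tauE AE; set Q := normsq y in Q0 sE tauE *.
have S1 : \sum_(i < N) s i ^+ 2 = 4 / Q.
  rewrite (eq_bigr (fun i => 4 / Q ^+ 2 * y 0 i ^+ 2)).
    by rewrite -mulr_sumr -/(normsq y) -/Q; field.
  by move=> i _; rewrite sE; field.
have S2 : \sum_(i < N) tau i = - (4 * k) / Q.
  rewrite (eq_bigr _ (fun i _ => tauE i)) sumrB S1 sumr_const card_ord.
  by rewrite -[2 / _ *+ N]mulr_natr Nk; field.
have S3 j : \sum_(i < N) s i * A i j = 2 * y 0 j / Q.
  rewrite (eq_bigr (fun i => y 0 j * s i ^+ 2 + s i * (j == i)%:R)).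
    by rewrite big_split /= -mulr_sumr S1 sum_delta sE; field.
  by move=> i _; rewrite AE; ring.
(* [A] is the matrix of the reflection in the hyperplane orthogonal to [y], hence symmetric and
   orthogonal. *)
have S4 j l : \sum_(i < N) A i j * A i l = (j == l)%:R.
  rewrite (eq_bigr (fun i => y 0 j * y 0 l * s i ^+ 2
      + (s i * y 0 j) * (l == i)%:R + (s i * y 0 l) * (j == i)%:R
      + (l == i)%:R * (j == i)%:R)).
    rewrite !big_split /= -mulr_sumr S1 !sum_delta !sE [l == j]eq_sym.
    by field.
  by move=> i _; rewrite !AE; ring.
(* Collects the coefficients of [U], of each [w j] and of each [H j l]. The first is a multiple of
   [4 k / Q - 4 k / Q], the second of [2 (2 k + 1) - 4 k - 2]. *)
transitivity (k * G * U * (k * (\sum_(i < N) s i ^+ 2) + \sum_(i < N) tau i)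
  + \sum_(j < N) G * r * w j * ((2 * k + 1) * (\sum_(i < N) s i * A i j)
       + y 0 j * (\sum_(i < N) tau i) + \sum_(i < N) s i * (j == i)%:R)
  + G * r ^+ 2 * \sum_(j < N) \sum_(l < N) H j l * \sum_(i < N) A i j * A i l).
  under [X in _ + X + _]eq_bigr do
    rewrite !mulr_sumr -!big_split /= mulr_sumr.
  rewrite !mulr_sumr -big_split /= mulr_sumr.
  under [X in _ + _ + X]eq_bigr do rewrite mulr_sumr.
  under [X in _ + _ + X]eq_bigr do under eq_bigr do rewrite !mulr_sumr.
  rewrite exchange_big /=.
  under [X in _ + _ + X]eq_bigr do rewrite exchange_big.
  rewrite [X in _ + _ + X]exchange_big /= -!big_split /=.
  apply: eq_bigr => i _.
  rewrite !mulr_sumr -!addrA; congr (_ + _); first by ring.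
  rewrite -!big_split /=; apply: eq_bigr => j _.
  rewrite mulrDr !mulr_sumr addrA; congr (_ + _); first by ring.
  by apply: eq_bigr => l _; ring.
rewrite S1 S2.
rewrite [X in _ + X + _]big1 => [|j _]; last first.
  by rewrite S3 sum_delta sE; field.
rewrite (eq_bigr (fun j => H j j)) => [|j _]; first by field.
under eq_bigr do rewrite S4.
exact: sum_delta.
Qed.

(* For [L = lambda ^ 2] and [k = (N - 2) / 2] this is the Kelvin transform
   [(lambda / |y|) ^ (N - 2) * u (lambda ^ 2 *: y / |y| ^ 2)] (a junk value at
   [y = 0], where the division gives [0]). *)
Definition kelvin (R : realType) (N : nat) (L k : R) (u : 'rV[R]_N -> R)
    (y : 'rV[R]_N) : R :=
  (L / normsq y) `^ k * u ((L / normsq y) *: y).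

Lemma is_derive_sum_fun (R : realType) (N : nat) (h : 'I_N -> R -> R)
    (dh : 'I_N -> R) (t : R) :
  (forall j, is_derive (t : R) 1 (h j) (dh j)) ->
  is_derive (t : R) 1 (fun s => \sum_(j < N) h j s) (\sum_(j < N) dh j).
Proof.
move=> Dh; have := @is_derive_sum _ _ _ N h t 1 dh Dh.
by congr (is_derive _ _ _ _); apply/funext => s; rewrite fct_sumE.
Qed.

Lemma has_lap_kelvin (R : realType) (N : nat) (L k : R) (u : 'rV[R]_N -> R)
    (y : 'rV[R]_N) :
  is_C2 u -> 0 < L -> 0 < normsq y -> N%:R = 2 * k + 2 ->
  has_lap (kelvin L k u) y
    ((L / normsq y) `^ k * (L / normsq y) ^+ 2
     * laplacian u ((L / normsq y) *: y)).
Proof.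
move=> [u1 u2] L0 y0 Nk; have y0' : normsq y != 0 by rewrite gt_eqF.
set Q := normsq y in y0 y0' *; set r := L / Q.
pose s i := logder Q (y 0 i) 0.
pose tau i := s i ^+ 2 - 2 / Q.
pose A i j := s i * y 0 j + (j == i)%:R.
have sE i : s i = - (2 * y 0 i) / Q.
  by rewrite /s /logder mulr0 expr0n !addr0.
have KS := @kelvin_sum R N y (fun j => pderiv j u (r *: y))
  (fun j l => pderiv l (pderiv j u) (r *: y)) k (r `^ k) r (u (r *: y))
  s tau A y0' Nk sE (fun=> erefl) (fun _ _ => erefl).
(* Rewriting the claimed value backwards along [KS] makes its summands the witnesses for the second
   derivatives along the axes. *)
eexists; last by rewrite /laplacian -KS.
move=> i /=; set a := y 0 i.
pose q t := Q + 2 * a * t + t ^+ 2.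
pose S t := logder Q a t.
pose c t := (L / q t) *: (y + t *: delta_mx 0 i).
(* [c] is the image of the coordinate line under inversion, and [L / q t * B j t] is the derivative
   of its [j]-th coordinate. *)
pose B j t := S t * (y 0 j + t * (j == i)%:R) + (j == i)%:R.
pose G t := (L / q t) `^ k.
have q0 : q 0 = Q by rewrite /q; ring.
have c0 : c 0 = r *: y by rewrite /c q0 scale0r addr0.
have B0 j : B j 0 = A i j by rewrite /B /A mul0r addr0.
have q00 : 0 < q 0 by rewrite q0.
have S0 : S 0 = s i by [].
have Dr t : 0 < q t -> is_derive (t : R) 1 (fun t => L / q t) (L / q t * S t).
  exact: is_derive_inv_quadratic.
have DG t : 0 < q t -> is_derive (t : R) 1 G (k * (G t * S t)).
  move=> qt; apply: is_derive_powR_comp; first by rewrite divr_gt0.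
  exact: Dr.
have Dz j t : is_derive (t : R) 1 (fun t => y 0 j + t * (j == i)%:R) (j == i)%:R.
  have H := is_deriveD (is_derive_cst (y 0 j) t 1)
    (is_deriveM (is_derive_id t (1 : R)) (is_derive_cst ((j == i)%:R : R) t 1)).
  apply: is_derive_eq H _.
  by rewrite /= scaler0 !add0r [_ *: _]mulr1.
have Dc j t : 0 < q t ->
    is_derive (t : R) 1 (fun t => c t 0 j) (L / q t * B j t).
  move=> qt; have H := is_deriveM (Dr t qt) (Dz j t).
  have -> : (fun t => c t 0 j)
      = (fun t => L / q t * (y 0 j + t * (j == i)%:R)).
    by apply/funext => x; rewrite !mxE eqxx.
  apply: is_derive_eq H _.
  by rewrite /B -![_ *: _]/(_ * _); ring.
have DS : is_derive (0 : R) 1 S (tau i).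
  by apply: is_derive_eq (is_derive_logder q00) _; rewrite -/(q 0) q0.
have DB j : is_derive (0 : R) 1 (B j) (tau i * y 0 j + s i * (j == i)%:R).
  have H := is_deriveD (is_deriveM DS (Dz j 0)) (is_derive_cst ((j == i)%:R : R) (0 : R) 1).
  apply: is_derive_eq H _.
  by rewrite S0 -![_ *: _]/(_ * _); ring.
exists (fun t => k * (G t * S t) * u (c t)
    + G t * \sum_(j < N) L / q t * B j t * pderiv j u (c t)).
  have qc : {for (0 : R), continuous q}.
    apply: differentiable_continuous; apply/derivable1_diffP.
    by have [] := is_derive_quadratic Q a 0.
  have : \forall t \near (0 : R), 0 < q t by exact: qc _ (lt_nbhsr q00).
  apply: filterS => t qt.
  have -> : (fun t => kelvin L k u (y + t *: delta_mx 0 i))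
      = (fun t => G t * (u \o c) t).
    by apply/funext => x; rewrite /kelvin normsq_line.
  have H := is_deriveM (DG t qt) (is_C1_chain u1 (fun j => Dc j t qt)).
  apply: is_derive_eq H _.
  by rewrite -![_ *: _]/(_ * _) /=; ring.
have D0 := @is_deriveZ _ _ _ (fun t => G t * S t) k (0 : R) 1 _
  (is_deriveM (DG 0 q00) DS).
have D1 := is_deriveM D0
  (is_C1_chain u1 (fun j => Dc j 0 q00)).
have D2 := is_deriveM (DG 0 q00) (@is_derive_sum_fun R N
   (fun j t => L / q t * B j t * pderiv j u (c t)) _ 0
   (fun j => is_deriveM (is_deriveM (Dr 0 q00) (DB j))
     (is_C1_chain (u2 j) (fun j => Dc j 0 q00)))).
apply: is_derive_eq (is_deriveD D1 D2) _.
rewrite -![_ *: _]/(_ * _) /=.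
have G0 : G 0 = r `^ k by rewrite /G q0.
rewrite !G0 !S0 !q0 !c0.
have E1 : \sum_(j < N) L / Q * B j 0 * pderiv j u (r *: y)
    = \sum_(j < N) r * A i j * pderiv j u (r *: y).
  by apply: eq_bigr => j _; rewrite B0.
rewrite !E1 -![_ *: (_ : R)]/(_ * _).
rewrite [X in _ + (_ * X + _) = _](eq_bigr (fun j =>
  (r * s i * A i j + r * (tau i * y 0 j + s i * (j == i)%:R))
    * pderiv j u (r *: y)
  + r * A i j * \sum_(l < N) r * A i l * pderiv l (pderiv j u) (r *: y))).
  by ring.
move=> j _; rewrite -![_ *: (_ : R)]/(_ * _) /= fctE q0 B0 -/r.
rewrite (eq_bigr (fun l => r * A i l * pderiv l (pderiv j u) (r *: y))).
  by ring.
by move=> l _; rewrite B0.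
Qed.

(** * Minimum principles on annuli and exterior domains *)

Lemma sqr_norm_le_normsq (R : realType) (N : nat) (y : 'rV[R]_N) :
  `|y| ^+ 2 <= normsq y.
Proof.
have [->|y0] := eqVneq `|y| 0; first by rewrite expr0n normsq_ge0.
have [[i0 i] E] : exists ij, `|y| = `|y ij.1 ij.2| := mx_norm_neq0 y0.
rewrite E /= (ord1 i0) real_normK ?num_real //.
by rewrite /normsq (bigD1 i) //= lerDl sumr_ge0 // => j _; exact: sqr_ge0.
Qed.

Lemma annulus_compact (R : realType) (N : nat) (A B : R) :
  compact [set y : 'rV[R]_N | A <= normsq y <= B].
Proof.
apply: bounded_closed_compact.
  exists (B + 1); split; first exact: num_real.
  move=> M BM y /= /andP[_ yB].
  (* The square gives 2 |y| <= |y|^2 + 1 <= B + 1. *)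
  have := sqr_norm_le_normsq y; have := sqr_ge0 (`|y| - 1).
  by have := normr_ge0 y; nra.
have -> : [set y : 'rV[R]_N | A <= normsq y <= B]
    = @normsq R N @^-1` `[A, B]%classic.
  by apply/seteqP; split => y /=; rewrite in_itv.
apply: closed_comp; last exact: interval_closed.
by move=> y _; exact: normsq_continuous.
Qed.

Lemma annulus_argmin (R : realType) (N : nat) (f : 'rV[R]_N -> R) (A B : R)
    (z : 'rV[R]_N) :
  (forall y, A <= normsq y <= B -> {for y, continuous f}) ->
  A <= normsq z <= B ->
  exists2 c, A <= normsq c <= B &
    forall y, A <= normsq y <= B -> f c <= f y.
Proof.
move=> fc zAB.
pose K : set 'rV[R]_N := [set y | A <= normsq y <= B].
have K0 : K !=set0 by exists z.
have fK : {within K, continuous f}.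
  by apply: continuous_in_subspaceT => y; rewrite inE; exact: fc.
have [c cK cmin] := EVT_min_rV K0 (@annulus_compact R N A B) fK.
exists c; first by rewrite inE in cK.
by move=> y yK; apply: cmin; rewrite inE.
Qed.

Lemma annulus_min_principle (R : realType) (N : nat) (f : 'rV[R]_N -> R)
    (A B : R) :
  (forall y, A <= normsq y <= B -> {for y, continuous f}) ->
  (forall y, normsq y = A -> 0 <= f y) ->
  (forall y, normsq y = B -> 0 <= f y) ->
  (forall y, A < normsq y < B -> exists2 l, l < 0 & has_lap f y l) ->
  forall y, A <= normsq y <= B -> 0 <= f y.
Proof.
move=> fc fA fB flap y yAB.
have [c cAB cmin] := annulus_argmin fc yAB.
apply: le_trans (cmin _ yAB); move: (cAB) => /andP[cA cB].
have [|Ac] := leP (normsq c) A.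
  by move=> cA'; apply: fA; apply/eqP; rewrite eq_le cA cA'.
have [|Bc] := leP B (normsq c).
  by move=> cB'; apply: fB; apply/eqP; rewrite eq_le cB cB'.
have [|l l0 lf] := flap c; first by rewrite Ac Bc.
suff : 0 <= l by rewrite leNgt l0.
apply: has_lap_min lf _.
have cc := @normsq_continuous R N c.
near=> z; apply: cmin; apply/andP; split.
  by apply/ltW; near: z; exact: cc _ (lt_nbhsr Ac).
by apply/ltW; near: z; exact: cc _ (lt_nbhsl Bc).
Unshelve. all: by end_near. Qed.

Lemma inv_powR_continuous (R : realType) (N : nat) (L b : R) (y : 'rV[R]_N) :
  0 < L -> 0 < normsq y ->
  {for y, continuous (fun x => (L / normsq x) `^ b)}.
Proof.
move=> L0 y0.
have c1 : {for L / normsq y, continuous (fun x : R => x `^ b)}.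
  apply: differentiable_continuous; apply/derivable1_diffP.
  by have [] := @is_derive1_powR R b _ (divr_gt0 L0 y0).
have c2 : {for y, continuous (fun x : 'rV[R]_N => L / normsq x)}.
  apply: (@cvgM _ _ (nbhs y) _ (fun=> L) (fun x => (normsq x)^-1)).
    exact: cvg_cst.
  by apply: cvgV; [rewrite gt_eqF|exact: normsq_continuous].
exact: (@continuous_comp _ _ _ _ (fun x : R => x `^ b) y c2 c1).
Qed.

(** Since x^c >= 1 + c ln x, passing from exponent [k + c] to [k] costs at most m x^k c |ln x|; the
    choice [c = e / M] makes this at most [e]. *)
Lemma le_powR_gt (R : realType) (m x k a : R) :
  0 <= m -> 0 < x -> (forall b, k < b -> m * x `^ b <= a) -> m * x `^ k <= a.
Proof.
move=> m0 x0 H; apply/ler_addgt0Pr => e e0.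
have mk : 0 <= m * x `^ k by rewrite mulr_ge0 // powR_ge0.
pose M := m * x `^ k * `|ln x| + 1.
have M0 : 0 < M by rewrite ltr_wpDl // mulr_ge0.
have c0 : 0 < e / M by rewrite divr_gt0.
have := H (k + e / M); rewrite ltrDl => /(_ c0).
rewrite powRD; last by rewrite (gt_eqF x0) implybT.
rewrite mulrA => Hb.
have E : 1 + e / M * ln x <= x `^ (e / M).
  by rewrite /powR gt_eqF // expR_ge1Dx.
have := ler_wpM2l mk E; move=> /le_trans /(_ Hb).
have : m * x `^ k * `|ln x| * (e / M) <= e.
  by rewrite mulrCA ler_piMr ?(ltW e0) // ler_pdivrMr // mul1r lerDl ler01.
have : - `|ln x| <= ln x by rewrite lerNl -normrN ler_norm.
move=> /(ler_wpM2l (mulr_ge0 mk (ltW c0))).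
rewrite mulrDr mulr1; lra.
Qed.

(* For [b > k] the barrier [(A / normsq y) `^ b] is strictly subharmonic, so the
   minimum principle for strict inequalities suffices; then [b] tends to [k]. *)
Lemma superharmonic_exterior (R : realType) (N : nat) (f : 'rV[R]_N -> R)
    (A k m : R) :
  0 < A -> 0 <= k -> N%:R = 2 * k + 2 -> 0 <= m ->
  (forall y, A <= normsq y -> {for y, continuous f}) ->
  (forall y, A <= normsq y -> 0 <= f y) ->
  (forall y, A < normsq y -> exists2 l, l <= 0 & has_lap f y l) ->
  (forall y, normsq y = A -> m <= f y) ->
  forall y, A <= normsq y -> m * (A / normsq y) `^ k <= f y.
Proof.
move=> A0 k0 Nk + fc f0 flap fm y Ay.
rewrite le_eqVlt => /predU1P[<-|m0]; first by rewrite mul0r f0.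
have qy : 0 < normsq y by apply: lt_le_trans Ay.
apply: le_powR_gt; [exact: ltW|exact: divr_gt0|move=> b kb].
have b0 : 0 < b by apply: le_lt_trans kb.
apply/ler_addgt0Pr => e e0.
(* [t] solves m t^b = e, and the outer sphere [B] is so large that [A / B <= t]: there the barrier
   is at most [e], so that [f >= 0] suffices as boundary condition once [e] is added. *)
pose t := (e / m) `^ b^-1.
have t0 : 0 < t by apply: powR_gt0; rewrite divr_gt0.
have tb : t `^ b = e / m.
  by rewrite /t -powRrM mulVf ?gt_eqF // powRr1 // divr_ge0 // ltW.
pose B := normsq y + A / t.
have yB : normsq y < B by rewrite ltrDl divr_gt0.
have B0 : 0 < B by apply: lt_trans yB.
have bar : m * (A / B) `^ b <= e.
  rewrite mulrC -ler_pdivlMr // -tb ge0_ler_powR ?(ltW b0) ?nnegrE //.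
  - by rewrite divr_ge0 // ltW.
  - exact: ltW.
  - by rewrite ler_pdivrMr // mulrC -ler_pdivrMr // lerDr ltW.
pose h x := f x + (e + - m * (A / normsq x) `^ b).
suff : 0 <= h y by rewrite /h; lra.
apply: (@annulus_min_principle R N h A B) => [x /andP[Ax xB]|x xA|x xB|x|].
- have x0 : 0 < normsq x by apply: lt_le_trans Ax.
  have c2 := @inv_powR_continuous R N A b x A0 x0.
  exact: cvgD (fc x Ax) (cvgD (cvg_cst e) (cvgM (cvg_cst (- m)) c2)).
- have := fm x xA; rewrite /h xA divff ?gt_eqF // powR1; move: e0; lra.
- have Ax : A <= normsq x by rewrite xB (le_trans Ay) // ltW.
  have := f0 x Ax; rewrite /h xB; move: bar; lra.
- move=> /andP[Ax _]; have x0 : 0 < normsq x by apply: lt_trans Ax.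
  have [l l0 Hl] := flap x Ax.
  exists (l + (0 + - m * (2 * b * (2 * b + 2 - N%:R)
             * ((A / normsq x) `^ b / normsq x)))); last first.
    apply: has_lapD => //; apply: has_lapD; first exact: has_lap_cst.
    by apply: has_lapZ; exact: has_lap_inv_powR.
  have : 0 < m * (2 * b * (2 * b + 2 - N%:R) * ((A / normsq x) `^ b / normsq x)).
    rewrite !mulr_gt0 ?invr_gt0 ?powR_gt0 ?divr_gt0 // Nk.
    move: kb; lra.
  rewrite add0r mulNr; move: l0; lra.
- by rewrite Ay ltW.
Qed.

(** * Translation, positivity and the planar case *)

Lemma derivable_translate (R : realType) (N : nat) (f : 'rV[R]_N -> R)
    (a x v : 'rV[R]_N) :
  derivable f (x + a) v -> derivable (fun z => f (z + a)) x v.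
Proof. by rewrite /derivable /=; under eq_fun do rewrite addrA. Qed.

Lemma pderiv_translate (R : realType) (N : nat) (f : 'rV[R]_N -> R)
    (a : 'rV[R]_N) (i : 'I_N) :
  pderiv i (fun z => f (z + a)) = (fun x => pderiv i f (x + a)).
Proof.
apply/funext => x; rewrite /pderiv /derive /=.
by under eq_fun do rewrite -addrA.
Qed.

Lemma continuous_translate (R : realType) (N : nat) (f : 'rV[R]_N -> R)
    (a : 'rV[R]_N) : continuous f ->
  continuous (fun x : 'rV[R]_N => f (x + a)).
Proof.
move=> fc x; apply: (@continuous_comp _ _ _ (fun z : 'rV[R]_N => z + a) f x);
  last exact: fc.
exact: cvgD (@cvg_id _ _) (cvg_cst a).
Qed.

Lemma is_C1_translate (R : realType) (N : nat) (f : 'rV[R]_N -> R)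
    (a : 'rV[R]_N) : is_C1 f -> is_C1 (fun x => f (x + a)).
Proof.
move=> [fc df dfc]; split=> [|i x|i].
- exact: continuous_translate.
- exact: derivable_translate.
- by rewrite pderiv_translate; exact: continuous_translate.
Qed.

Lemma classical_solution_translate (R : realType) (N : nat) (p : R)
    (u : 'rV[R]_N -> R) (a : 'rV[R]_N) :
  classical_solution p u -> classical_solution p (fun x => u (x + a)).
Proof.
move=> [[u1 u2] ueq]; split.
  split; first exact: is_C1_translate.
  by move=> i; rewrite pderiv_translate; exact: is_C1_translate.
move=> x.
have -> : laplacian (fun z => u (z + a)) x = laplacian u (x + a).
  by apply: eq_bigr => i _; rewrite !pderiv_translate.
exact: ueq.
Qed.

Lemma constant_solution (R : realType) (N : nat) (p : R) (u : 'rV[R]_N -> R) :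
  classical_solution p u -> (forall x y, u x <= u y) -> forall x, u x = 0.
Proof.
move=> [_ ueq] uc x.
have D0 i c : pderiv i (fun=> c) = (fun=> 0) :> ('rV[R]_N -> R).
  by apply/funext => z; rewrite /pderiv derive_cst.
have := ueq x.
rewrite (_ : laplacian u x = 0) ?add0r; last first.
  have -> : u = fun=> u x.
    by apply/funext => y; apply/eqP; rewrite eq_le !uc.
  by rewrite /laplacian big1 // => i _; rewrite !D0.
by move/eqP; rewrite powR_eq0 => /andP[/eqP].
Qed.

Lemma solution_exterior (R : realType) (N : nat) (p k A m : R)
    (u : 'rV[R]_N -> R) :
  classical_solution p u -> (forall x, 0 <= u x) ->
  0 < A -> 0 <= k -> N%:R = 2 * k + 2 -> 0 <= m ->
  (forall y, normsq y = A -> m <= u y) ->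
  forall y, A <= normsq y -> m * (A / normsq y) `^ k <= u y.
Proof.
move=> [u2 ueq] u0 A0 k0 Nk m0 um.
apply: superharmonic_exterior => // y _; first by case: u2 => -[uc _ _] _; exact: uc.
exists (laplacian u y); last exact: is_C2_has_lap.
by move/eqP: (ueq y); rewrite addr_eq0 => /eqP ->; rewrite oppr_le0 powR_ge0.
Qed.

Lemma normsq_gt0 (R : realType) (N : nat) (y : 'rV[R]_N) :
  y != 0 -> 0 < normsq y.
Proof.
move=> y0; apply: lt_le_trans (sqr_norm_le_normsq y).
by rewrite exprn_gt0 // normr_gt0.
Qed.

(** Passes from the sup norm balls of the topology to the Euclidean balls on which functions are
    compared. *)
Lemma nbhs0_normsq (R : realType) (N : nat) (P : 'rV[R]_N -> Prop) :
  (\forall y \near (0 : 'rV[R]_N), P y) ->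
  exists2 A : R, 0 < A & forall y, normsq y <= A -> P y.
Proof.
move=> /nbhs_ballP[d /= d0 Hd]; exists ((d / 2) ^+ 2).
  by rewrite exprn_gt0 // divr_gt0.
move=> y yd; apply: Hd; rewrite -ball_normE /= sub0r normrN.
have := le_trans (sqr_norm_le_normsq y) yd.
rewrite ler_pXn2r ?nnegrE //; last by rewrite divr_ge0 // ltW.
by move/le_lt_trans; apply; rewrite ltr_pdivrMr // ltr_pMr // ltr1n.
Qed.

(** By continuity [u] stays above [u a / 2] on a small sphere around [a], and the exterior bound
    carries a positive amount from there to [b]. *)
Lemma solution_gt0 (R : realType) (N : nat) (p k : R) (u : 'rV[R]_N -> R)
    (a b : 'rV[R]_N) :
  classical_solution p u -> (forall x, 0 <= u x) -> 0 <= k ->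
  N%:R = 2 * k + 2 -> 0 < u a -> 0 < u b.
Proof.
move=> us u0 k0 Nk ua.
have [->//|ab] := eqVneq b a.
have vs := classical_solution_translate a us.
have [[[vc _ _] _] _] := vs.
have ua2 : u a / 2 < u (0 + a).
  by rewrite add0r ltr_pdivrMr // ltr_pMr // ltr1n.
have [A A0 HA] := nbhs0_normsq (vc 0 _ (lt_nbhsr ua2)).
have q0 : 0 < normsq (b - a) by rewrite normsq_gt0 // subr_eq0.
(* The minimum keeps [b] outside the sphere. *)
pose A' := Num.min A (normsq (b - a)).
have A'0 : 0 < A' by rewrite lt_min A0.
have m0 : 0 < u a / 2 by rewrite divr_gt0.
have := @solution_exterior R N p k A' (u a / 2) _ vs (fun x => u0 _) A'0 k0 Nk
  (ltW m0) _ (b - a).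
rewrite subrK => H; apply: lt_le_trans (H _ _).
- by rewrite mulr_gt0 // powR_gt0 // divr_gt0.
- by move=> y yA; apply/ltW/HA; rewrite yA ge_min lexx.
- by rewrite ge_min lexx orbT.
Qed.

(* In the plane the exterior bound does not decay ([k = 0]): apply it outside
   discs shrinking to [a]. *)
Lemma solution_plane_le (R : realType) (N : nat) (p : R) (u : 'rV[R]_N -> R)
    (a b : 'rV[R]_N) :
  classical_solution p u -> (forall x, 0 <= u x) -> N%:R = 2 :> R ->
  u a <= u b.
Proof.
move=> us u0 N2; have [->//|ab] := eqVneq b a.
have vs := classical_solution_translate a us.
have [[[vc _ _] _] _] := vs.
apply/ler_addgt0Pr => e e0.
have [ea|ae] := leP (u a) e; first by rewrite (le_trans ea) // lerDr.
have uae : u a - e < u (0 + a) by rewrite add0r ltrBlDr ltrDl.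
have [A A0 HA] := nbhs0_normsq (vc 0 _ (lt_nbhsr uae)).
have q0 : 0 < normsq (b - a) by rewrite normsq_gt0 // subr_eq0.
pose A' := Num.min A (normsq (b - a)).
have A'0 : 0 < A' by rewrite lt_min A0.
have m0 : 0 <= u a - e by rewrite subr_ge0 ltW.
have := @solution_exterior R N p 0 A' (u a - e) _ vs (fun x => u0 _) A'0 (lexx _)
  _ m0 _ (b - a).
rewrite subrK powRr0 mulr1 lerBlDr; apply.
- by rewrite mulr0 add0r.
- by move=> y yA; apply/ltW/HA; rewrite yA ge_min lexx.
- by rewrite ge_min lexx orbT.
Qed.

(** * The moving sphere inequality *)

Definition kelvin_le (R : realType) (N : nat) (k : R) (u : 'rV[R]_N -> R)
    (L : R) : Prop :=
  forall y, L <= normsq y -> kelvin L k u y <= u y.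

(** The derivative at [s = 1] of [s ^ k * u (s *: y)]. That function takes the value
    [kelvin L k u y] at [s = L / normsq y] and [u y] at [s = 1], so the inequality follows wherever
    it is nondecreasing in between. *)
Definition radial (R : realType) (N : nat) (k : R) (u : 'rV[R]_N -> R)
    (y : 'rV[R]_N) : R :=
  k * u y + \sum_(j < N) y 0 j * pderiv j u y.

Lemma radial_continuous (R : realType) (N : nat) (k : R) (u : 'rV[R]_N -> R) :
  is_C1 u -> continuous (radial k u).
Proof.
move=> [uc _ duc] y; have c1 : {for y, continuous (fun z => k * u z)}.
  exact: cvgM (cvg_cst k) (uc y).
apply: (cvgD c1).
apply: (@cvg_sum_fin R _ (nbhs y) _ _
  (fun j (z : 'rV[R]_N) => z 0 j * pderiv j u z)) => j.
by apply: cvgM; [exact: coord_continuous|exact: duc].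
Qed.

Lemma is_derive_radial (R : realType) (N : nat) (k : R) (u : 'rV[R]_N -> R)
    (y : 'rV[R]_N) (s : R) : is_C1 u -> 0 < s ->
  is_derive (s : R) 1 (fun t : R => t `^ k * u (t *: y))
    (s `^ k / s * radial k u (s *: y)).
Proof.
move=> u1 s0.
have D1 := @is_derive1_powR R k s s0.
have D2 j : is_derive (s : R) 1 (fun t : R => (t *: y) 0 j) (y 0 j).
  have -> : (fun t : R => (t *: y) 0 j) = (fun t => t * y 0 j).
    by apply/funext => t; rewrite mxE.
  apply: is_derive_eq (is_deriveM (is_derive_id s (1 : R))
    (is_derive_cst (y 0 j) s 1)) _.
  by rewrite scaler0 add0r [_ *: _]mulr1.
have D3 := @is_C1_chain R N u (fun t => t *: y) _ s u1 D2.
apply: is_derive_eq (is_deriveM D1 D3) _.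
rewrite -![_ *: (_ : R)]/(_ * _) /= /radial mulrDr addrC; congr (_ + _).
  rewrite powRB ?powRr1 ?(ltW s0) ?(gt_eqF s0) ?implybT //; ring.
rewrite !mulr_sumr; apply: eq_bigr => j _; rewrite mxE.
by field; rewrite gt_eqF.
Qed.

Lemma radial_ge0_le (R : realType) (N : nat) (k : R) (u : 'rV[R]_N -> R)
    (y : 'rV[R]_N) (rho : R) : is_C1 u -> 0 < rho <= 1 ->
  (forall s, rho < s < 1 -> 0 <= radial k u (s *: y)) ->
  rho `^ k * u (rho *: y) <= u y.
Proof.
move=> u1 /andP[r0]; rewrite le_eqVlt => /predU1P[->|r1] Hr.
  by rewrite powR1 mul1r scale1r.
have D s : 0 < s -> _ := @is_derive_radial R N k u y s u1.
have [||c] := @MVT R (fun t => t `^ k * u (t *: y))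
  (fun s => s `^ k / s * radial k u (s *: y)) rho 1 r1.
- by move=> s; rewrite in_itv /= => /andP[rs _]; apply: D; apply: lt_trans rs.
- apply: derivable_within_continuous => s; rewrite in_itv /= => /andP[rs _].
  by have [] := D s (lt_le_trans r0 rs).
rewrite in_itv /= => /andP[rc c1] E.
have c0 : 0 < c by apply: lt_trans rc.
rewrite powR1 mul1r scale1r in E; rewrite -subr_ge0 E.
rewrite !mulr_ge0 ?powR_ge0 ?invr_ge0 ?(ltW c0) ?subr_ge0 ?(ltW r1) //.
by apply: Hr; rewrite rc.
Qed.

(** [f s - f s^-1] vanishes at 1 with derivative [2 * d] and is nonnegative to the right of 1. On a
    ray, inversion in the sphere acts as [s |-> s^-1]. *)
Lemma is_derive_reflect_ge0 (R : realType) (f : R -> R) (d : R) :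
  is_derive (1 : R) 1 f d -> (forall s, 1 <= s <= 2 -> f s^-1 <= f s) ->
  0 <= d.
Proof.
move=> Df Hf; rewrite leNgt; apply/negP => d0.
have D1 : is_derive (1 : R) 1 (fun s : R => s^-1) (- 1).
  have n1 : (1 : R) != 0 by rewrite oner_eq0.
  apply: is_derive_eq (@is_deriveV R id 1 1 1 n1 (is_derive_id _ _)) _.
  by rewrite /= expr1n invr1 [_ *: _]mulr1.
have D2 : is_derive (1 : R) 1 (fun s : R => f s^-1) (- d).
  have Df' : is_derive ((1 : R)^-1) 1 f d by rewrite invr1.
  apply: is_derive_eq (@is_derive1_comp R f (fun s => s^-1) 1 _ _ Df' D1) _.
  by rewrite mulrN1.
have D3 : is_derive (1 : R) 1 (fun s : R => f s - f s^-1) (2 * d).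
  by apply: is_derive_eq (is_deriveB Df D2) _; ring.
have := is_derive_quotient D3.
have d2 : 0 < - (2 * d) by rewrite oppr_gt0 pmulr_rlt0.
move/cvgrPdist_lt => /(_ _ d2).
rewrite /dnbhs /within /= => /nbhs_ballP[r /= r0 Hr].
pose h := Num.min (r / 2) 1.
have h0 : 0 < h by rewrite lt_min ltr01 divr_gt0.
have hr : h < r by rewrite gt_min ltr_pdivrMr // ltr_pMr // ltr1n.
have h1 : h <= 1 by rewrite ge_min lexx orbT.
have := Hr h; rewrite -ball_normE /= sub0r normrN gtr0_norm // => /(_ hr).
move=> /(_ (lt0r_neq0 h0)); rewrite invr1 subrr subr0.
have : 0 <= h^-1 * (f (h + 1) - f (h + 1)^-1).
  rewrite mulr_ge0 ?invr_ge0 ?(ltW h0) // subr_ge0 Hf //; move: h0 h1; lra.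
by rewrite ltr_norml; lra.
Qed.

Lemma kelvin_continuous (R : realType) (N : nat) (L k : R)
    (u : 'rV[R]_N -> R) (y : 'rV[R]_N) :
  continuous u -> 0 < L -> 0 < normsq y -> {for y, continuous (kelvin L k u)}.
Proof.
move=> uc L0 y0.
have c2 : {for y, continuous (fun x : 'rV[R]_N => L / normsq x)}.
  apply: (@cvgM _ _ (nbhs y) _ (fun=> L) (fun x => (normsq x)^-1)).
    exact: cvg_cst.
  by apply: cvgV; [rewrite gt_eqF|exact: normsq_continuous].
apply: (cvgM (@inv_powR_continuous R N L k y L0 y0)).
have c3 : {for y, continuous (fun x : 'rV[R]_N => (L / normsq x) *: x)}.
  exact: cvgZ c2 (@cvg_id _ _).
exact: (@continuous_comp _ _ _ _ u y c3 (uc _)).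
Qed.

(** Near 0 [radial] is positive, being [k * u 0] at 0, so monotonicity along rays applies. Farther
    out, [u] has the lower bound of a superharmonic function, while the transform only sees values
    of [u] near 0 and carries the small factor [L ^ k]. *)
Lemma kelvin_le_small (R : realType) (N : nat) (p k : R) (u : 'rV[R]_N -> R) :
  classical_solution p u -> (forall x, 0 < u x) -> 0 < k ->
  N%:R = 2 * k + 2 ->
  exists2 L0, 0 < L0 & forall L, 0 < L <= L0 -> kelvin_le k u L.
Proof.
move=> us u0 k0 Nk.
have [[u1 u2] _] := us; have [uc _ _] := u1.
have N0 : (0 < N)%N.
  by rewrite -(ltr_nat R) Nk; move: k0; lra.
have G0 : 0 < radial k u 0.
  by rewrite /radial big1 ?addr0 ?mulr_gt0 // => j _; rewrite mxE mul0r.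
have [A A0 HA] := nbhs0_normsq (@radial_continuous R N k u u1 0 _ (lt_nbhsr G0)).
have [e eA] := exists_normsq N0 (ltW A0).
have eA1 : A <= normsq e <= A by rewrite eA lexx.
have eA2 : 0 <= normsq e <= A by rewrite eA lexx ltW.
have [c cA cmin] := @annulus_argmin R N u A A e (fun y _ => uc y) eA1.
have [d dA dmax] := @annulus_argmin R N (fun y => - u y) 0 A e
  (fun y _ => cvgN (uc y)) eA2.
pose m := u c; pose M := u d.
have m0 : 0 < m by exact: u0.
have M0 : 0 < M by exact: u0.
have um y : normsq y = A -> m <= u y by move=> yA; apply: cmin; rewrite yA lexx.
have uM y : normsq y <= A -> u y <= M.
  by move=> yA; rewrite -lerN2; apply: dmax; rewrite yA normsq_ge0.
have mM : m <= M by apply: uM; case/andP: cA.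
(* [L0] solves L0^k M = A^k m; as [m <= M], also [L0 <= A], which keeps inverted points in the ball
   where [u <= M]. *)
pose L0 := A * (m / M) `^ k^-1.
have mMk : (m / M) `^ k^-1 <= 1.
  have <- : 1 `^ k^-1 = 1 :> R by rewrite powR1.
  rewrite ge0_ler_powR ?nnegrE ?invr_ge0 ?(ltW k0) ?divr_ge0 //.
  - exact: ltW.
  - exact: ltW.
  - by rewrite ler_pdivrMr // mul1r.
have L0A : L0 <= A by rewrite /L0 ler_piMr // ltW.
exists L0; first by rewrite mulr_gt0 // powR_gt0 // divr_gt0.
move=> L /andP[Lp LL0] y Ly.
have q0 : 0 < normsq y by apply: lt_le_trans Ly.
have r01 : 0 < L / normsq y <= 1.
  by rewrite divr_gt0 //= ler_pdivrMr // mul1r.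
have [yA|/ltW Ay] := leP (normsq y) A.
  apply: radial_ge0_le => // s /andP[rs s1]; apply/ltW/HA.
  have s0 : 0 < s by apply: lt_trans rs; case/andP: r01.
  rewrite normsqZ (le_trans _ yA) // ler_piMl ?normsq_ge0 //.
  by rewrite expr_le1 // ltW.
have := @solution_exterior R N p k A m u us (fun x => ltW (u0 x)) A0 (ltW k0) Nk
  (ltW m0) um y Ay.
apply: le_trans; rewrite /kelvin.
apply: (@le_trans _ _ ((L / normsq y) `^ k * M)).
  rewrite ler_wpM2l ?powR_ge0 //; apply: uM.
  rewrite normsqZ expr_div_n.
  have -> : L ^+ 2 / normsq y ^+ 2 * normsq y = L * (L / normsq y).
    by field; rewrite gt_eqF.
  case/andP: r01 => _ r1.
  by rewrite (le_trans _ (le_trans LL0 L0A)) // ler_piMr // ltW.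
rewrite mulrC !powRM ?invr_ge0 ?(ltW A0) ?(ltW Lp) ?(ltW q0) //.
rewrite !mulrA ler_wpM2r ?powR_ge0 //.
have : L `^ k <= L0 `^ k.
  by rewrite ge0_ler_powR ?nnegrE ?(ltW k0) ?(ltW Lp) // (le_trans _ LL0) // ltW.
rewrite /L0 powRM ?powR_ge0 ?(ltW A0) // -powRrM mulVf ?gt_eqF // powRr1; last first.
  by rewrite divr_ge0 // ltW.
move=> /(ler_wpM2l (ltW M0)) /le_trans; apply.
rewrite le_eqVlt; apply/orP; left; apply/eqP; field.
by rewrite gt_eqF.
Qed.

(** With [r = L / normsq y < 1] the transform V satisfies Delta V = - r^(k + 2 - k p) V^p.
    Subcriticality makes this exponent positive, so the Laplacian of u - V is less than V^p - u^p <=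
    0. *)
Lemma kelvin_diff_lap (R : realType) (N : nat) (p k L : R)
    (u : 'rV[R]_N -> R) (y : 'rV[R]_N) :
  classical_solution p u -> (forall x, 0 < u x) -> 0 < p ->
  N%:R = 2 * k + 2 -> p * k < k + 2 -> 0 < L -> L < normsq y ->
  kelvin L k u y <= u y ->
  exists2 l, l < 0 & has_lap (fun x => u x - kelvin L k u x) y l.
Proof.
move=> [u2 ueq] u0 p0 Nk pk L0 Ly uV.
have q0 : 0 < normsq y by apply: lt_trans Ly.
have lapE z : laplacian u z = - (u z `^ p).
  by apply/eqP; rewrite -addr_eq0 ueq.
set r := L / normsq y.
have r0 : 0 < r by rewrite divr_gt0.
have r1 : r < 1 by rewrite ltr_pdivrMr // mul1r.
exists (laplacian u y + - 1 * (r `^ k * r ^+ 2 * laplacian u (r *: y))).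
  rewrite !lapE mulN1r mulrN opprK addrC subr_lt0.
  have U0 : 0 < u (r *: y) `^ p by apply: powR_gt0.
  apply: (@lt_le_trans _ _ ((r `^ k * u (r *: y)) `^ p)); last first.
    by rewrite ge0_ler_powR ?nnegrE ?mulr_ge0 ?powR_ge0 ?(ltW (u0 _)) ?(ltW p0).
  rewrite powRM ?powR_ge0 ?(ltW (u0 _)) // ltr_pM2r // -powRrM.
  have -> : r `^ k * r ^+ 2 = r `^ (k * p) * r `^ (k + 2 - k * p).
    rewrite -powR_mulrn ?(ltW r0) // -!powRD ?(gt_eqF r0) ?implybT //.
    by congr (_ `^ _); ring.
  rewrite -[ltRHS]mulr1 ltr_pM2l ?powR_gt0 //.
  have c0 : 0 < k + 2 - k * p by rewrite subr_gt0 mulrC.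
  have := gt0_ltr_powR c0 _ _ r1.
  by rewrite powR1 !nnegrE ler01 ltW // => /(_ isT isT).
have -> : (fun x => u x - kelvin L k u x) = (fun x => u x + - 1 * kelvin L k u x).
  by apply/funext => x; rewrite mulN1r.
by apply: has_lapD; [exact: is_C2_has_lap|apply: has_lapZ; exact: has_lap_kelvin].
Qed.

Lemma kelvin_diff_continuous (R : realType) (N : nat) (L k : R)
    (u : 'rV[R]_N -> R) (y : 'rV[R]_N) :
  continuous u -> 0 < L -> 0 < normsq y ->
  {for y, continuous (fun x => u x - kelvin L k u x)}.
Proof.
move=> uc L0 y0; exact: cvgB (uc y) (@kelvin_continuous R N L k u y uc L0 y0).
Qed.

(** A point of equality would be a local minimum of the difference, where its Laplacian is
    negative. *)
Lemma kelvin_lt (R : realType) (N : nat) (p k L : R) (u : 'rV[R]_N -> R) :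
  classical_solution p u -> (forall x, 0 < u x) -> 0 < p ->
  N%:R = 2 * k + 2 -> p * k < k + 2 -> 0 < L -> kelvin_le k u L ->
  forall y, L < normsq y -> kelvin L k u y < u y.
Proof.
move=> us u0 p0 Nk pk L0 PL y Ly.
rewrite lt_neqAle PL ?(ltW Ly) // andbT; apply/eqP => E.
have [l l0 Hl] := kelvin_diff_lap us u0 p0 Nk pk L0 Ly (PL y (ltW Ly)).
suff : 0 <= l by rewrite leNgt l0.
apply: has_lap_min Hl _; rewrite E subrr.
have cc := @normsq_continuous R N y.
near=> z; rewrite subr_ge0; apply: PL; apply/ltW.
by near: z; exact: cc _ (lt_nbhsr Ly).
Unshelve. all: by end_near. Qed.

(** The difference is itself superharmonic outside the sphere and has a positive minimum on
    [normsq y = B], so the exterior bound applies to it. *)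
Lemma kelvin_gap (R : realType) (N : nat) (p k L B : R) (u : 'rV[R]_N -> R) :
  classical_solution p u -> (forall x, 0 < u x) -> 0 < p -> 0 < k ->
  N%:R = 2 * k + 2 -> p * k < k + 2 -> 0 < L -> kelvin_le k u L -> L < B ->
  exists2 c, 0 < c & forall y, B <= normsq y ->
    kelvin L k u y + c * (L / normsq y) `^ k <= u y.
Proof.
move=> us u0 p0 k0 Nk pk L0 PL LB.
have N0 : (0 < N)%N by rewrite -(ltr_nat R) Nk; move: k0; lra.
have B0 : 0 < B by apply: lt_trans LB.
have [[uc _ _] _] := us.1.
pose w x := u x - kelvin L k u x.
have wc y : B <= normsq y -> {for y, continuous w}.
  by move=> By; apply: kelvin_diff_continuous => //; apply: lt_le_trans By.
have [e eB] := exists_normsq N0 (ltW B0).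
have eB' : B <= normsq e <= B by rewrite eB lexx.
have [d /andP[dB _] dmin] :=
  @annulus_argmin R N w B B e (fun y yB => wc y (andP yB).1) eB'.
have m0 : 0 < w d by rewrite subr_gt0 (kelvin_lt us) // (lt_le_trans LB).
exists (w d) => // y By.
have := @superharmonic_exterior R N w B k (w d) B0 (ltW k0) Nk (ltW m0) wc
  _ _ _ y By.
rewrite addrC -lerBrDr => H; apply: le_trans (H _ _ _).
- have q0 : 0 < normsq y by apply: lt_le_trans By.
  rewrite ler_wpM2l ?(ltW m0) // ge0_ler_powR ?nnegrE ?(ltW k0) //.
  + by rewrite divr_ge0 ?ltW.
  + by rewrite divr_ge0 ?ltW.
  + by rewrite ler_pM2r ?invr_gt0 // ltW.
- by move=> z Bz; rewrite subr_ge0 PL // (le_trans (ltW LB)).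
- move=> z Bz; have Lz : L < normsq z by apply: lt_trans Bz.
  have [l l0 Hl] := kelvin_diff_lap us u0 p0 Nk pk L0 Lz (PL z (ltW Lz)).
  by exists l => //; exact: ltW.
- by move=> z zB; apply: dmin; rewrite zB lexx.
Qed.

(* Hopf's lemma on the sphere, where the difference [u - kelvin L k u]
   vanishes. *)
Lemma kelvin_radial_gt0 (R : realType) (N : nat) (p k L : R)
    (u : 'rV[R]_N -> R) (y : 'rV[R]_N) :
  classical_solution p u -> (forall x, 0 < u x) -> 0 < p -> 0 < k ->
  N%:R = 2 * k + 2 -> p * k < k + 2 -> 0 < L -> kelvin_le k u L ->
  normsq y = L -> 0 < radial k u y.
Proof.
move=> us u0 p0 k0 Nk pk L0 PL yL.
have [u1 _] := us.1; have [uc _ _] := u1.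
(* The annulus then contains [s *: y] for all [1 <= s <= 2]. *)
pose B := 4 * L.
have LB : L < B by rewrite /B; move: L0; lra.
have B0 : 0 < B by apply: lt_trans LB.
pose w x := u x - kelvin L k u x.
have wc z : L <= normsq z -> {for z, continuous w}.
  by move=> Lz; apply: kelvin_diff_continuous => //; apply: lt_le_trans Lz.
have yB : B <= normsq (2 *: y) <= B.
  by rewrite normsqZ yL /B -natrX lexx.
have wcB z : B <= normsq z <= B -> {for z, continuous w}.
  by move=> /andP[Bz _]; apply: wc; rewrite (le_trans (ltW LB)).
have [d /andP[dB _] dmin] := annulus_argmin wcB yB.
pose m := w d.
have m0 : 0 < m by rewrite subr_gt0 (kelvin_lt us) // (lt_le_trans LB).
(* The subtracted barrier [m * (1 - (L / normsq x) ^ k)] is harmonic, vanishes on the inner sphere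
   and stays below [m] on the outer one. *)
pose h x := w x + (- m + m * (L / normsq x) `^ k).
have h0 : forall z, L <= normsq z <= B -> 0 <= h z.
  apply: annulus_min_principle.
  - move=> z /andP[Lz _]; have z0 : 0 < normsq z by apply: lt_le_trans Lz.
    have c2 := @inv_powR_continuous R N L k z L0 z0.
    exact: cvgD (wc z Lz) (cvgD (cvg_cst (- m)) (cvgM (cvg_cst m) c2)).
  - move=> z zL; rewrite /h /w /kelvin zL divff ?gt_eqF // powR1 mul1r scale1r.
    by rewrite subrr add0r mulr1 addNr.
  - move=> z zB; have := dmin z; rewrite zB lexx => /(_ isT) wz.
    have : 0 <= m * (L / normsq z) `^ k by rewrite mulr_ge0 ?powR_ge0 ?ltW.
    by rewrite /h; move: wz; rewrite -/m; lra.
  - move=> z /andP[Lz _]; have z0 : 0 < normsq z by apply: lt_trans Lz.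
    have [l l0 Hl] := kelvin_diff_lap us u0 p0 Nk pk L0 Lz (PL z (ltW Lz)).
    exists (l + (0 + m * (2 * k * (2 * k + 2 - N%:R)
               * ((L / normsq z) `^ k / normsq z)))).
      by rewrite Nk subrr mulr0 mul0r mulr0 !addr0.
    apply: has_lapD => //; apply: has_lapD; first exact: has_lap_cst.
    by apply: has_lapZ; exact: has_lap_inv_powR.
have D1 := @is_derive_radial R N k u y 1 u1 ltr01.
have D2 := @is_derive1_powR R k 1 ltr01.
(* For this function, [f s - f s^-1] is [s ^ k * h (s *: y)]; the term [m * k] in its derivative
   supplies the strict inequality. *)
have D3 : is_derive (1 : R) 1 (fun s : R => s `^ k * u (s *: y) - m * s `^ k)
    (radial k u y - m * k).
  apply: is_derive_eq (is_deriveB D1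
    (@is_deriveZ _ _ _ (fun s : R => s `^ k) m (1 : R) 1 _ D2)) _.
  by rewrite !powR1 scale1r divr1 mul1r mulr1.
suff : 0 <= radial k u y - m * k.
  by rewrite subr_ge0; apply: lt_le_trans; rewrite mulr_gt0.
apply: is_derive_reflect_ge0 D3 _ => s /andP[s1 s2].
have s0 : 0 < s by apply: lt_le_trans s1.
have sn : s != 0 by rewrite gt_eqF.
have := h0 (s *: y); rewrite /h /w /kelvin normsqZ yL.
have -> : L / (s ^+ 2 * L) = s^-1 * s^-1 by field; rewrite sn gt_eqF.
rewrite scalerA mulfVK // powRM ?invr_ge0 ?(ltW s0) // => /(_ _) H.
have {}H : 0 <= u (s *: y) - s^-1 `^ k * s^-1 `^ k * u (s^-1 *: y)
    + (- m + m * (s^-1 `^ k * s^-1 `^ k)).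
  apply: H; rewrite ler_peMl ?(ltW L0) ?exprn_ege1 //= /B ler_wpM2r ?(ltW L0) //.
  by rewrite (_ : 4 = 2 ^+ 2) ?lerXn2r ?nnegrE ?(ltW s0) // -natrX.
have E : s `^ k * s^-1 `^ k = 1.
  by rewrite -powRM ?invr_ge0 ?(ltW s0) // divff // powR1.
rewrite -subr_ge0; have := mulr_ge0 (powR_ge0 s k) H.
set a := s `^ k in E *; set b := s^-1 `^ k in E *.
suff -> : a * (u (s *: y) - b * b * u (s^-1 *: y) + (- m + m * (b * b)))
    = a * u (s *: y) - (a * b) * b * u (s^-1 *: y)
      + (- (m * a) + m * (a * b) * b).
  rewrite E; suff -> : a * u (s *: y) - 1 * b * u (s^-1 *: y)
      + (- (m * a) + m * 1 * b)
    = a * u (s *: y) - m * a - (b * u (s^-1 *: y) - m * b) by [].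
  by ring.
by ring.
Qed.

Lemma scaled_powR_continuous (R : realType) (N : nat) (k L : R)
    (u : 'rV[R]_N -> R) (z : 'rV[R]_N) :
  continuous u -> 0 < L ->
  {for (z, L), continuous (fun w : 'rV[R]_N * R => w.2 `^ k * u (w.2 *: w.1))}.
Proof.
move=> uc L0.
have c1 : {for L, continuous (fun x : R => x `^ k)}.
  apply: differentiable_continuous; apply/derivable1_diffP.
  by have [] := @is_derive1_powR R k L L0.
have c2 : {for (z, L), continuous (fun w : 'rV[R]_N * R => w.2 `^ k)}.
  exact: (@continuous_comp _ _ _ (@snd 'rV[R]_N R) (fun x : R => x `^ k) (z, L)
    cvg_snd c1).
have c3 : {for (z, L), continuous (fun w : 'rV[R]_N * R => w.2 *: w.1)}.
  exact: cvgZ cvg_snd cvg_fst.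
apply: cvgM c2 _.
exact: (@continuous_comp _ _ _ _ u (z, L) c3 (uc _)).
Qed.

(* Near the sphere [normsq y = L] the inequality for [M] follows from the strict
   monotonicity of [s |-> s `^ k * u (s *: y)] there; beyond it there is a gap
   of order [|y| ^ (2 - N)], which survives small changes of [L] because
   [y / normsq y] stays in a compact ball. *)
Lemma kelvin_le_near (R : realType) (N : nat) (p k L : R)
    (u : 'rV[R]_N -> R) :
  classical_solution p u -> (forall x, 0 < u x) -> 0 < p -> 0 < k ->
  N%:R = 2 * k + 2 -> p * k < k + 2 -> 0 < L -> kelvin_le k u L ->
  \forall M \near L, kelvin_le k u M.
Proof.
move=> us u0 p0 k0 Nk pk L0 PL.
have [u1 _] := us.1; have [uc _ _] := u1.
have sphere : \forall s \near (1 : R), forall y : 'rV[R]_N,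
    L <= normsq y <= L -> 0 < radial k u (s *: y).
  have /compact_near_coveringP cov := @annulus_compact R N L L.
  apply: (cov R (nbhs (1 : R)) (fun s y => 0 < radial k u (s *: y))) => y yL.
  have G0 : 0 < radial k u ((1 : R) *: y).
    rewrite scale1r; apply: (@kelvin_radial_gt0 R N p k L) => //.
    by apply/eqP; rewrite eq_le andbC.
  have c3 : {for (y, 1 : R), continuous (fun w : 'rV[R]_N * R => w.2 *: w.1)}.
    exact: cvgZ cvg_snd cvg_fst.
  have := @continuous_comp _ _ _ _ (radial k u) (y, 1 : R) c3
    (@radial_continuous R N k u u1 _).
  exact: (fun c => c _ (lt_nbhsr G0)).
have [d /= d0 Hd] := (nbhs_ballP _ _).1 sphere.
pose e := Num.min (d / 2) (1 / 2).
have e0 : 0 < e by rewrite lt_min !divr_gt0.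
have ed : e < d by rewrite gt_min ltr_pdivrMr // ltr_pMr // ltr1n.
have e1 : e <= 1 / 2 by rewrite ge_min lexx orbT.
have {Hd} shell (s : R) (y : 'rV[R]_N) : normsq y = L -> 1 - e <= s <= 1 + e ->
    0 < radial k u (s *: y).
  move=> yL se; apply: Hd; last by rewrite yL lexx.
  rewrite -ball_normE /= distrC (le_lt_trans _ ed) // ler_norml.
  by move: se; lra.
pose B := L * (1 + e) ^+ 2.
have LB : L < B.
  by rewrite /B ltr_pMr // exprn_egt1 // ltrDl.
have B0 : 0 < B by apply: lt_trans LB.
have [c c0 gap] := kelvin_gap us u0 p0 k0 Nk pk L0 PL LB.
(* For [z = y / normsq y], dividing by [(normsq y)^-1 ^ k] turns the comparison far out into one
   between continuous functions of [(z, M)]. *)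
have ball : \forall M \near L, forall z : 'rV[R]_N, 0 <= normsq z <= B^-1 ->
    M `^ k * u (M *: z) < L `^ k * u (L *: z) + c * L `^ k.
  have /compact_near_coveringP cov := @annulus_compact R N 0 B^-1.
  apply: (cov R (nbhs L) (fun M z =>
    M `^ k * u (M *: z) < L `^ k * u (L *: z) + c * L `^ k)) => z _.
  have c1 := @scaled_powR_continuous R N k L u z uc L0.
  have c2 : {for (z, L), continuous (fun w : 'rV[R]_N * R =>
      L `^ k * u (L *: w.1))}.
    have c3 : {for (z, L), continuous (fun w : 'rV[R]_N * R => L *: w.1)}.
      exact: cvgZ (cvg_cst L) cvg_fst.
    exact: cvgM (cvg_cst (L `^ k)) (@continuous_comp _ _ _ _ u (z, L) c3 (uc _)).
  have D0 : L `^ k * u (L *: z) - L `^ k * u (L *: z) < c * L `^ k.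
    by rewrite subrr mulr_gt0 // powR_gt0.
  have c4 : {for (z, L), continuous (fun w : 'rV[R]_N * R =>
      w.2 `^ k * u (w.2 *: w.1) - L `^ k * u (L *: w.1))}.
    exact: cvgB c1 c2.
  have c5 : \forall w \near (z, L),
      w.2 `^ k * u (w.2 *: w.1) - L `^ k * u (L *: w.1) < c * L `^ k.
    exact: c4 _ (lt_nbhsl D0).
  by apply: filterS c5 => w /=; rewrite ltrBlDl.
(* For [M] above this bound, every [s > M / normsq y] satisfies [s * s0 >= 1 - e], where
   [s0 <= 1 + e] is the distance of [y] in units of the radius; the segment from the inverted point
   to [y] thus stays in the shell. *)
have ltL : (1 - e) * (1 + e) * L < L.
  have -> : (1 - e) * (1 + e) * L = L - e ^+ 2 * L by ring.
  by rewrite ltrBlDr ltrDl mulr_gt0 // exprn_gt0.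
near=> M.
have M0 : 0 < M by near: M; exact: lt_nbhsr.
have LM : (1 - e) * (1 + e) * L < M by near: M; exact: lt_nbhsr.
have HM : forall z : 'rV[R]_N, 0 <= normsq z <= B^-1 ->
    M `^ k * u (M *: z) < L `^ k * u (L *: z) + c * L `^ k by near: M.
move=> y My.
have q0 : 0 < normsq y by apply: lt_le_trans My.
have qn : normsq y != 0 by rewrite gt_eqF.
have [yB|By] := leP (normsq y) B.
  pose s0 := Num.sqrt (normsq y / L).
  have qL : 0 < normsq y / L by rewrite divr_gt0.
  have s0p : 0 < s0 by rewrite sqrtr_gt0.
  have s0E : s0 ^+ 2 = normsq y / L by rewrite sqr_sqrtr // ltW.
  have s0n : s0 != 0 by rewrite gt_eqF.
  have e1p : 0 <= 1 + e by rewrite addr_ge0 // ltW.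
  have s0e : s0 <= 1 + e.
    rewrite -(@ler_pXn2r _ 2) ?nnegrE ?(ltW s0p) // s0E.
    by rewrite ler_pdivrMr // mulrC.
  have y0L : normsq (s0^-1 *: y) = L.
    by rewrite normsqZ exprVn s0E; field; rewrite gt_eqF.
  apply: radial_ge0_le => //.
    by rewrite divr_gt0 //= ler_pdivrMr // mul1r.
  move=> s /andP[rs s1]; apply: ltW.
  have sp : 0 < s by apply: lt_trans rs; rewrite divr_gt0.
  have -> : s *: y = (s * s0) *: (s0^-1 *: y).
    by rewrite scalerA mulfK.
  apply: shell => //; apply/andP; split; last first.
    by rewrite (le_trans _ s0e) // ler_piMl // ltW.
  have : M < s * (s0 ^+ 2 * L).
    by rewrite s0E mulfVK ?gt_eqF // -ltr_pdivrMr.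
  move=> /(lt_trans LM); rewrite mulrA ltr_pM2r // expr2 mulrA => H.
  have : s * s0 * s0 <= s * s0 * (1 + e) by rewrite ler_wpM2l // mulr_ge0 // ltW.
  move=> /(lt_le_trans H); rewrite ltr_pM2r; last by rewrite ltr_wpDl.
  exact: ltW.
have := gap y (ltW By); apply: le_trans.
have zB : 0 <= normsq ((normsq y)^-1 *: y) <= B^-1.
  rewrite normsq_ge0 normsqZ exprVn expr2 invfM -mulrA mulVf // mulr1.
  by rewrite lef_pV2 ?posrE // ltW.
have := HM _ zB; rewrite !scalerA.
rewrite /kelvin !powRM ?invr_ge0 ?(ltW q0) ?(ltW L0) ?(ltW M0) //.
have i0 : 0 <= (normsq y)^-1 `^ k by exact: powR_ge0.
move=> /ltW /(ler_wpM2l i0) H.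
rewrite [leLHS](_ : _ = (normsq y)^-1 `^ k * (M `^ k * u ((M / normsq y) *: y)));
  last by ring.
apply: le_trans H _; rewrite le_eqVlt; apply/orP; left; apply/eqP; ring.
Unshelve. all: by end_near. Qed.

(** * All radii, and constancy *)

Lemma kelvin_le_all (R : realType) (N : nat) (p k : R)
    (u : 'rV[R]_N -> R) (L : R) :
  classical_solution p u -> (forall x, 0 < u x) -> 0 < p -> 0 < k ->
  N%:R = 2 * k + 2 -> p * k < k + 2 -> 0 < L -> kelvin_le k u L.
Proof.
move=> us u0 p0 k0 Nk pk L0; apply: contrapT => PL.
have [[uc _ _] _] := us.1.
pose S : set R := [set M | 0 < M /\ forall M', 0 < M' <= M -> kelvin_le k u M'].
have [M0 M00 HM0] := kelvin_le_small us u0 k0 Nk.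
have SM0 : S M0 by [].
have ubS : ubound S L.
  move=> M [M1 HM]; rewrite leNgt; apply/negP => /ltW LM.
  by apply: PL; apply: HM; rewrite L0.
have supS : has_sup S by split; [exists M0|exists L].
pose b := sup S.
have b0 : 0 < b by exact: lt_le_trans M00 (ub_le_sup supS.2 SM0).
have below M : 0 < M < b -> kelvin_le k u M.
  move=> /andP[M1 Mb].
  have [s [s0 Hs] Ms] := sup_gt (ex_intro _ M0 SM0) Mb.
  by apply: Hs; rewrite M1 ltW.
(* For fixed [y] the transform is continuous in the radius, and [y] lies outside all smaller
   spheres: a failure at [b] would occur already slightly below [b]. *)
have Pb : kelvin_le k u b.
  move=> y yb; rewrite leNgt; apply/negP => H.
  have q0 : 0 < normsq y by apply: lt_le_trans yb.
  have c1 : {for b, continuous (fun M : R => kelvin M k u y)}.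
    have c2 : {for b, continuous (fun M : R => (y, M / normsq y))}.
      have c3 : {for b, continuous (fun M : R => M / normsq y)}.
        exact: cvgM (@cvg_id _ _) (cvg_cst _).
      exact: cvg_pair (cvg_cst y) c3.
    exact: (@continuous_comp _ _ _ _ _ b c2
      (@scaled_powR_continuous R N k (b / normsq y) u y uc (divr_gt0 b0 q0))).
  have near1 : \forall M \near b, u y < kelvin M k u y by exact: c1 _ (lt_nbhsr H).
  have near2 : \forall M \near b, 0 < M by exact: lt_nbhsr.
  have [d /= d0 Hd] := (nbhs_ballP _ _).1 (filterI near1 near2).
  have db : ball b d (b - d / 2).
    rewrite -ball_normE /= opprB addrC subrK gtr0_norm ?divr_gt0 //.
    by rewrite ltr_pdivrMr // ltr_pMr // ltr1n.
  have [H1 H2] := Hd _ db.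
  have lb : b - d / 2 < b by rewrite ltrBlDr ltrDl divr_gt0.
  have := below (b - d / 2); rewrite H2 lb => /(_ isT) /(_ y).
  rewrite (le_trans (ltW lb)) // => /(_ isT).
  by rewrite leNgt H1.
have [d /= d0 Hd] := (nbhs_ballP _ _).1
  (kelvin_le_near us u0 p0 k0 Nk pk b0 Pb).
have : S (b + d / 2).
  split; first by rewrite addr_gt0 // divr_gt0.
  move=> M /andP[M1 Mb]; have [Mb'|bM] := ltP M b; first by apply: below; rewrite M1.
  apply: Hd; rewrite -ball_normE /= distrC ger0_norm ?subr_ge0 //.
  by move: Mb d0; lra.
move=> /(ub_le_sup supS.2); rewrite -/b.
by move: d0; lra.
Qed.

(* The center [x] on the line through [y] and [z] is chosen so that inversion
   maps [y] to [z] with ratio [r]; it goes to infinity as [r] tends to [1]. *)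
Lemma positive_solution_le (R : realType) (N : nat) (p k : R)
    (u : 'rV[R]_N -> R) (y z : 'rV[R]_N) :
  classical_solution p u -> (forall x, 0 < u x) -> 0 < p -> 0 < k ->
  N%:R = 2 * k + 2 -> p * k < k + 2 -> u z <= u y.
Proof.
move=> us u0 p0 k0 Nk pk; have [->//|yz] := eqVneq y z.
rewrite leNgt; apply/negP => uyz.
(* Any [c] strictly between [u y / u z] and 1 will do: the transform at [y] will equal [c * u z],
   which exceeds [u y]. *)
pose c := (u y / u z + 1) / 2.
have uy1 : u y / u z < 1 by rewrite ltr_pdivrMr // mul1r.
have uy0 : 0 < u y / u z by rewrite divr_gt0.
have c0 : 0 < c by rewrite /c; move: uy0; lra.
have c1 : c < 1 by rewrite /c; move: uy1; lra.
have cu : u y < c * u z.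
  by rewrite -ltr_pdivrMr // /c; move: uy1; lra.
pose r := c `^ k^-1.
have rk : r `^ k = c by rewrite /r -powRrM mulVf ?gt_eqF // powRr1 // ltW.
have r0 : 0 < r by apply: powR_gt0.
have r1 : r < 1.
  have ki : 0 < k^-1 by rewrite invr_gt0.
  have := gt0_ltr_powR ki _ _ c1.
  by rewrite powR1 !nnegrE ler01 ltW // => /(_ isT isT).
have r1' : 0 < 1 - r by rewrite subr_gt0.
pose Y := (1 - r)^-1 *: (y - z).
pose x := y - Y.
have Y0 : 0 < normsq Y.
  by rewrite normsqZ mulr_gt0 ?exprn_gt0 ?invr_gt0 // normsq_gt0 // subr_eq0.
have vs := classical_solution_translate x us.
have L0 : 0 < r * normsq Y by rewrite mulr_gt0.
have := kelvin_le_all vs (fun _ => u0 _) p0 k0 Nk pk L0.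
move=> /(_ Y); rewrite ler_piMl ?(ltW r1) ?(ltW Y0) // => /(_ isT).
rewrite /kelvin mulfK ?gt_eqF // rk.
have -> : Y + x = y by rewrite /x addrC subrK.
have -> : r *: Y + x = z.
  rewrite /x addrCA addrC -[r *: Y - Y]opprB -{1}[Y]scale1r -scalerBl.
  by rewrite /Y scalerA divff ?gt_eqF // scale1r opprB subrK.
by rewrite leNgt cu.
Qed.

Theorem theorem1 (R : realType) (N : nat) (p : R) (u : 'rV[R]_N -> R)
    (N_ge2 : (2 <= N)%N)
    (p_gt1 : 1 < p)
    (p_subcritical : (p%:E < sobolev_exponent R N)%E)
    (u_ge0 : forall x : 'rV[R]_N, 0 <= u x)
    (u_sol : classical_solution p u) :
  forall x : 'rV[R]_N, u x = 0.
Proof.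
apply: (constant_solution u_sol) => x y.
move: p_subcritical; rewrite /sobolev_exponent.
case: eqP => [N2 _|/eqP N2].
  have NR : N%:R = 2 :> R by rewrite N2.
  exact: solution_plane_le u_sol u_ge0 NR.
rewrite lte_fin => pS.
have N3 : 2 < N%:R :> R by rewrite ltr_nat ltn_neqAle eq_sym N2.
pose k : R := (N%:R - 2) / 2.
have k0 : 0 < k by rewrite divr_gt0 // subr_gt0.
have Nk : N%:R = 2 * k + 2 by rewrite /k; field.
(* Since [k + 2 = (N + 2) / 2], this is p < (N + 2) / (N - 2) multiplied by [k]. *)
have pk : p * k < k + 2.
  by move: pS; rewrite ltr_pdivlMr ?subr_gt0 // /k; lra.
have p0 : 0 < p by apply: lt_trans p_gt1.
have [ux|ux] := leP (u x) 0; first exact: le_trans ux (u_ge0 y).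
apply: (@positive_solution_le R N p k) => // z.
exact: (solution_gt0 z u_sol u_ge0 (ltW k0) Nk ux).
Qed.
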